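(* Let $\mathbb{K}$ be a field, let $A=\mathbb{K}[X_1,\dots,X_n]$ be the standard graded polynomial ring, and let $I\subseteq A$ be a weakly stable ideal. Let $A_{\mathbb{Q}}=\mathbb{Q}[X_1,\dots,X_n]$ and let $I_{\mathbb{Q}}\subseteq A_{\mathbb{Q}}$ be the monomial ideal generated by the same monomials that generate $I$. Then, for all $i$, $$\operatorname{Hilb}\left(H^i_{\mathfrak{m}_A}(A/I)\right)=\operatorname{Hilb}\left(H^i_{\mathfrak{m}_{A_{\mathbb{Q}}}}(A_{\mathbb{Q}}/I_{\mathbb{Q}})\right).$$
   Context: For a standard graded polynomial ring $R$ over a field, $\mathfrak{m}_R$ denotes its graded maximal ideal and $H^i_{\mathfrak{m}_R}(-)$ denotes graded local cohomology with support in $\mathfrak{m}_R$. For a graded module $M=\bigoplus_j M_j$ over a polynomial ring over a field $F$ with all $\dim_F M_j<\infty$, $\operatorname{Hilb}(M)=\sum_{j\in\mathbb{Z}}(\dim_F M_j)\,t^j$, with $\operatorname{Hilb}(M)_j=\dim_F M_j$. A linear form $l$ of $A$ is filter-regular for a graded $A$-module $M=\bigoplus_{d\in\mathbb{Z}}M_d$ if the multiplication map $M_d\xrightarrow{\cdot l}M_{d+1}$ is injective for all sufficiently large $d$. A sequence of linear forms $l_1,\dots,l_r$ is a filter-regular sequence for $M$ if $l_j$ is filter-regular for $M/(l_1,\dots,l_{j-1})M$ for all $j=1,\dots,r$. A monomial ideal $I$ of $A$ is weakly stable if $X_n,X_{n-1},\dots,X_1$ (in this order) is a filter-regular sequence for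 $A/I$. *)

(* Defs.v *)
From HB Require Import structures.
From mathcomp Require Import all_boot all_order all_algebra.
From mathcomp Require Import generic_quotient ring_quotient boolp.
From mathcomp Require Import mpoly.

Set Implicit Arguments.
Unset Strict Implicit.
Unset Printing Implicit Defensive.

Import GRing.Theory Num.Theory.
Local Open Scope ring_scope.
Local Open Scope quotient_scope.

Section QuotientModule.
Variables (R : nzRingType) (V : lmodType R) (S : submodClosed V).

Fact submod_zmod_closed : zmod_closed S.
Proof. by split=> [|x y hx hy]; rewrite ?rpred0 // -scaleN1r rpredD ?rpredZ. Qed.

Definition submod_zmodClosed : zmodClosed V :=
  HB.pack (fun x : V => x \in S) (GRing.isZmodClosed.Build V (fun x : V => x \in S) submod_zmod_closed).

Definition lmod_quot := Quotient.quot submod_zmodClosed.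
HB.instance Definition _ := GRing.Zmodule.on lmod_quot.

Definition lmod_pi (x : V) : lmod_quot := \pi_(Quotient.quot submod_zmodClosed) x.
Definition lmod_repr (x : lmod_quot) : V :=
  repr (x : Quotient.quot submod_zmodClosed).

Lemma lmod_reprK : cancel lmod_repr lmod_pi.
Proof. by move=> x; rewrite /lmod_pi reprK. Qed.

Lemma lmod_piP (x y : V) : reflect (lmod_pi x = lmod_pi y) (x - y \in S).
Proof.
rewrite -[x - y \in S]/(x - y \in submod_zmodClosed) Quotient.idealrBE.
exact: eqP.
Qed.

Fact lmod_pi_zmod_morphism : zmod_morphism lmod_pi.
Proof.
exact: (raddfB (\pi_(Quotient.quot submod_zmodClosed) : {additive V -> _})).
Qed.
HB.instance Definition _ :=
  GRing.isZmodMorphism.Build V lmod_quot lmod_pi lmod_pi_zmod_morphism.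

Definition lmod_quot_scale (a : R) (x : lmod_quot) : lmod_quot :=
  lmod_pi (a *: lmod_repr x).

Lemma lmod_quot_scale_pi a x : lmod_quot_scale a (lmod_pi x) = lmod_pi (a *: x).
Proof.
apply/lmod_piP; rewrite -scalerBr; apply: rpredZ.
by apply/lmod_piP; rewrite lmod_reprK.
Qed.

Fact lmod_quot_scalerA a b x :
  lmod_quot_scale a (lmod_quot_scale b x) = lmod_quot_scale (a * b) x.
Proof. by rewrite -[x]lmod_reprK !lmod_quot_scale_pi scalerA. Qed.

Fact lmod_quot_scale1r : left_id 1 lmod_quot_scale.
Proof. by move=> x; rewrite -[x]lmod_reprK lmod_quot_scale_pi scale1r. Qed.

Fact lmod_quot_scalerDr : right_distributive lmod_quot_scale +%R.
Proof.
move=> a x y; rewrite -[x]lmod_reprK -[y]lmod_reprK -raddfD.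
by rewrite !lmod_quot_scale_pi scalerDr raddfD.
Qed.

Fact lmod_quot_scalerDl x : {morph lmod_quot_scale^~ x : a b / a + b}.
Proof.
by move=> a b; rewrite -[x]lmod_reprK !lmod_quot_scale_pi scalerDl raddfD.
Qed.

HB.instance Definition _ := GRing.Zmodule_isLmodule.Build R lmod_quot
  lmod_quot_scalerA lmod_quot_scale1r lmod_quot_scalerDr lmod_quot_scalerDl.

Fact lmod_pi_scalable : scalable lmod_pi.
Proof. by move=> a x; rewrite -lmod_quot_scale_pi. Qed.
HB.instance Definition _ :=
  GRing.isScalable.Build R V lmod_quot *:%R lmod_pi lmod_pi_scalable.

End QuotientModule.

(* A Z-grading M = (+)_d M_d is given by the projections gpart d : M -> M_d. *)
Record gradedModule (K : fieldType) (n : nat) := GradedModule {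
  gcar :> lmodType {mpoly K[n]};
  gpart : int -> gcar -> gcar;
  gpartB : forall d x y, gpart d (x - y) = gpart d x - gpart d y;
  gpart_gpart : forall d e x,
    gpart d (gpart e x) = if d == e then gpart e x else 0;
  gpart_sum : forall x, exists2 s : seq int,
    uniq s & x = \sum_(d <- s) gpart d x;
  gpartZ : forall d (e : nat) f x, f \is e.-homog ->
    gpart (d + e%:Z) (f *: x) = f *: gpart d x
}.

Definition homogeneous_of K n (M : gradedModule K n) (d : int) (x : M) : Prop :=
  gpart d x = x.

Record gradedSubmodule K n (M : gradedModule K n) := GradedSubmodule {
  gsub :> submodClosed M;
  gsub_gpart : forall d x, x \in gsub -> gpart d x \in gsub
}.

Section GradedTheory.
Variables (K : fieldType) (n : nat).
Implicit Type M : gradedModule K n.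

Lemma gpart0 M d : gpart d (0 : M) = 0.
Proof. by have := gpartB d (0 : M) 0; rewrite !subrr. Qed.

Lemma gpartN M d (x : M) : gpart d (- x) = - gpart d x.
Proof. by rewrite -sub0r gpartB gpart0 sub0r. Qed.

Lemma gpartD M d (x y : M) : gpart d (x + y) = gpart d x + gpart d y.
Proof. by rewrite -{1}(opprK y) gpartB gpartN opprK. Qed.

Lemma gpart_bigsum M d (I : Type) (r : seq I) (P : pred I) (F : I -> M) :
  gpart d (\sum_(i <- r | P i) F i) = \sum_(i <- r | P i) gpart d (F i).
Proof.
by elim/big_rec2: _ => [|i y1 y2 _ <-]; rewrite ?gpart0 ?gpartD.
Qed.

Section Quotient.
Variables (M : gradedModule K n) (N : gradedSubmodule M).
Local Notation pi := (lmod_pi N).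

Definition gquot_part (d : int) (x : lmod_quot N) : lmod_quot N :=
  pi (gpart d (lmod_repr x)).

Lemma gquot_part_pi d (x : M) : gquot_part d (pi x) = pi (gpart d x).
Proof.
apply/lmod_piP; rewrite -gpartB; apply: gsub_gpart.
by apply/lmod_piP; rewrite lmod_reprK.
Qed.

Fact gquot_partB d x y : gquot_part d (x - y) = gquot_part d x - gquot_part d y.
Proof.
rewrite -[x]lmod_reprK -[y]lmod_reprK -raddfB !gquot_part_pi gpartB.
exact: raddfB.
Qed.

Fact gquot_part_part d e x :
  gquot_part d (gquot_part e x) = if d == e then gquot_part e x else 0.
Proof.
rewrite -[x]lmod_reprK !gquot_part_pi gpart_gpart.
by case: ifP => // _; exact: raddf0.
Qed.

Fact gquot_part_sum x : exists2 s : seq int,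
  uniq s & x = \sum_(d <- s) gquot_part d x.
Proof.
have [s us xE] := gpart_sum (lmod_repr x); exists s => //.
by rewrite -{1}[x]lmod_reprK xE raddf_sum.
Qed.

Fact gquot_partZ d (e : nat) f x : f \is e.-homog ->
  gquot_part (d + e%:Z) (f *: x) = f *: gquot_part d x.
Proof.
move=> hf; rewrite -[x]lmod_reprK -linearZ !gquot_part_pi -linearZ /=.
by rewrite gpartZ.
Qed.

Definition gquot : gradedModule K n :=
  GradedModule gquot_partB gquot_part_part gquot_part_sum gquot_partZ.

End Quotient.

Section Span.
Variables (M : gradedModule K n) (S : M -> Prop).

Definition gspan_pred : {pred M} := fun x =>
  `[< exists2 s : seq ({mpoly K[n]} * M),
        forall p, p \in s -> S p.2 /\ exists d, homogeneous_of d p.2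
      & x = \sum_(p <- s) p.1 *: p.2 >].

Fact gspan_submod_closed : submod_closed gspan_pred.
Proof.
split=> [|a x y /asboolP[s hs ->] /asboolP[t ht ->]].
  by apply/asboolP; exists [::]; rewrite ?big_nil.
apply/asboolP; exists ([seq (a * p.1, p.2) | p <- s] ++ t).
  by move=> p; rewrite mem_cat => /orP[/mapP[q /hs ? ->]|/ht].
rewrite big_cat big_map scaler_sumr /=; congr (_ + _).
by apply: eq_bigr => p _; rewrite scalerA.
Qed.

HB.instance Definition _ :=
  GRing.isSubmodClosed.Build {mpoly K[n]} M gspan_pred gspan_submod_closed.

Fact gspan_gpart d x : x \in gspan_pred -> gpart d x \in gspan_pred.
Proof.
move=> /asboolP[s hs ->]; rewrite gpart_bigsum big_seq.
apply: rpred_sum => p ps; have [Sp [e he]] := hs p ps.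
have [g ->] : exists g, gpart d (p.1 *: p.2) = g *: p.2.
  rewrite (pihomog_partitionE (mf := mdeg) (p := p.1) (leqnn _)).
  rewrite scaler_suml gpart_bigsum.
  exists (\sum_(k < mmeasure mdeg p.1)
      (if d == e + k%:Z then pihomog mdeg k p.1 else 0)).
  rewrite scaler_suml; apply: eq_bigr => k _.
  have := gpartZ e p.2 (pihomogP mdeg k p.1); rewrite he => <-.
  rewrite gpart_gpart; case: ifP => [|_]; last by rewrite scale0r.
  by move=> _; have := gpartZ e p.2 (pihomogP mdeg k p.1); rewrite he.
by apply/asboolP; exists [:: (g, p.2)] => [q|];
  rewrite ?big_seq1 // inE => /eqP ->; split=> //; exists e.
Qed.

(* The graded submodule generated by the homogeneous elements of S. *)
Definition gspan : gradedSubmodule M := GradedSubmodule gspan_gpart.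

End Span.

Section PolynomialRing.
Local Notation A := ({mpoly K[n]}^o : lmodType {mpoly K[n]}).

Definition gpoly_part (d : int) (f : A) : A :=
  if d is Posz k then pihomog mdeg k (f : {mpoly K[n]}) else 0.

Fact gpoly_partB d f g : gpoly_part d (f - g) = gpoly_part d f - gpoly_part d g.
Proof. by case: d => k /=; rewrite ?subr0 // pihomogB. Qed.

Fact gpoly_part_part d e f :
  gpoly_part d (gpoly_part e f) = if d == e then gpoly_part e f else 0.
Proof.
case: d => k; case: e => l //=; rewrite ?if_same ?pihomog0 //.
rewrite eqz_nat; case: eqP => [->|/eqP ne]; first exact: pihomog_id.
by apply: (@pihomog_ne0 _ _ _ l); rewrite ?pihomogP // eq_sym.
Qed.

Fact gpoly_part_sum f : exists2 s : seq int,
  uniq s & f = \sum_(d <- s) gpoly_part d f.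
Proof.
exists [seq k%:Z | k <- iota 0 (mmeasure mdeg (f : {mpoly K[n]}))].
  by rewrite map_inj_uniq ?iota_uniq // => ? ? [].
rewrite big_map -[X in iota 0 X]subn0 big_mkord.
exact: (pihomog_partitionE (mf := mdeg) (leqnn _)).
Qed.

Lemma pihomog_homogM (e l : nat) (g f : {mpoly K[n]}) : g \is e.-homog ->
  pihomog mdeg l (g * f) = if (e <= l)%N then g * pihomog mdeg (l - e) f else 0.
Proof.
move=> hg; have fE (k : nat) : pihomog mdeg l (g * pihomog mdeg k f)
    = if l == (e + k)%N then g * pihomog mdeg k f else 0.
  have hk : g * pihomog mdeg k f \is (e + k).-homog.
    by apply: dhomogM => //; apply: pihomogP.
  case: eqP => [->|/eqP ne]; first exact: pihomog_dE.
  by apply: pihomog_ne0 hk; rewrite eq_sym.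
set N := maxn (mmeasure mdeg f) l.+1.
rewrite {1}(pihomog_partitionE (mf := mdeg) (p := f) (leq_maxl _ l.+1)) -/N.
rewrite mulr_sumr raddf_sum /=; under eq_bigr do rewrite fE.
case: leqP => [el|le]; last first.
  apply: big1 => k _; case: eqP => // lE.
  by move: le; rewrite lE ltnNge leq_addr.
have lt : (l - e < N)%N by rewrite /N leq_max ltnS leq_subr orbT.
rewrite (bigD1 (Ordinal lt)) //= subnKC // eqxx big1 ?addr0 // => k nk.
by case: eqP => // lE; case/eqP: nk; apply: val_inj; rewrite /= lE addKn.
Qed.

Fact gpoly_partZ d (e : nat) (g : {mpoly K[n]}) (f : A) : g \is e.-homog ->
  gpoly_part (d + e%:Z) (g *: f) = g *: gpoly_part d f.
Proof.
move=> hg; rewrite /gpoly_part; case: d => k.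
  by rewrite -PoszD (pihomog_homogM _ _ hg) leq_addl addnK.
rewrite scaler0; case dE: (_ + _) => [l|] //.
rewrite (pihomog_homogM _ _ hg) leqNgt; suff -> : (l < e)%N by [].
by rewrite -ltz_nat -dE NegzE gtrDr oppr_lt0.
Qed.

Definition gpoly : gradedModule K n :=
  GradedModule gpoly_partB gpoly_part_part gpoly_part_sum gpoly_partZ.

End PolynomialRing.

End GradedTheory.

Section WeaklyStable.
Variables (K : fieldType) (n : nat).
Implicit Type M : gradedModule K n.

Definition monomial_ideal (G : 'X_{1..n} -> Prop) : gradedSubmodule (gpoly K n) :=
  gspan (fun f : gpoly K n => exists2 u, G u & f = 'X_[u]).

(* For linear forms s this is (s)M, as each homogeneous component of l *: m  *)
(* is l times a homogeneous component of m.                                  *)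
Definition mul_submodule M (s : seq {mpoly K[n]}) : gradedSubmodule M :=
  gspan (fun x : M => exists2 l, l \in s & exists m : M, x = l *: m).

Definition filter_regular M (l : {mpoly K[n]}) : Prop :=
  l \is 1.-homog /\
  exists d0 : int, forall d, (d0 <= d)%O -> forall x y : M,
    homogeneous_of d x -> homogeneous_of d y -> l *: x = l *: y -> x = y.

Definition filter_regular_seq M (s : seq {mpoly K[n]}) : Prop :=
  forall j, (j < size s)%N ->
    filter_regular (gquot (mul_submodule M (take j s))) s`_j.

Definition weakly_stable (I : gradedSubmodule (gpoly K n)) : Prop :=
  filter_regular_seq (gquot I) [seq 'X_i | i <- rev (enum 'I_n)].

End WeaklyStable.

(* Local cohomology is the right derived functor of the m-torsion functor on  *)
(* graded modules: it is computed from injective resolutions in the category  *)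
(* of graded modules and homogeneous maps of degree 0.                        *)
Section LocalCohomology.
Variables (K : fieldType) (n : nat).
Implicit Types M N E : gradedModule K n.

Definition degree0 M N (f : M -> N) : Prop :=
  forall d x, f (gpart d x) = gpart d (f x).

Definition graded_injective E : Prop :=
  forall M N (u : {linear M -> N}) (f : {linear M -> E}),
    degree0 u -> injective u -> degree0 f ->
    exists2 g : {linear N -> E}, degree0 g & forall x, g (u x) = f x.

Record injective_resolution M := InjectiveResolution {
  res :> nat -> gradedModule K n;
  res_inj : forall p, graded_injective (res p);
  res_aug : {linear M -> res 0};
  res_aug_degree0 : degree0 res_aug;
  res_aug_inj : injective res_aug;
  res_diff : forall p, {linear res p -> res p.+1};
  res_diff_degree0 : forall p, degree0 (res_diff p);
  res_exact0 : forall y, res_diff 0 y = 0 <-> exists x, y = res_aug x;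
  res_exactS : forall p y,
    res_diff p.+1 y = 0 <-> exists x, y = res_diff p x
}.

(* m^k x = 0 for some k, where m is the ideal of polynomials without constant *)
(* term.                                                                      *)
Definition torsion M (x : M) : Prop :=
  exists k, forall s : seq {mpoly K[n]}, size s = k ->
    (forall f, f \in s -> f@_0%MM = 0) -> (\prod_(f <- s) f) *: x = 0.

(* dim_K (Z / B) = r, for K-subspaces B of Z of M. *)
Definition quot_dim M (Z B : M -> Prop) (r : nat) : Prop :=
  exists2 v : 'I_r -> M, forall k, Z (v k) &
    forall z, Z z ->
      exists! c : 'rV[K]_r, B (z - \sum_(k < r) (c 0 k)%:MP *: v k).

Section Cohomology.
Variables (M : gradedModule K n) (E : injective_resolution M).

Definition lc_cocycle (i : nat) (j : int) (x : E i) : Prop :=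
  [/\ homogeneous_of j x, torsion x & res_diff E i x = 0].

Definition lc_coboundary (i : nat) (j : int) : E i -> Prop :=
  match i with
  | 0 => fun x => x = 0
  | i'.+1 => fun x =>
      exists y, [/\ homogeneous_of j y, torsion y & x = res_diff E i' y]
  end.

(* dim_K H^i_m(M)_j = h j for all j, with H^i_m(M) computed from E. *)
Definition lc_Hilb (i : nat) (h : int -> nat) : Prop :=
  forall j, quot_dim (@lc_cocycle i j) (@lc_coboundary i j) (h j).

End Cohomology.

End LocalCohomology.

(* Main.v *)
(* Write C_L(E) for the elements of the resolution E killed by powers of the   *)
(* variables X_l, l in L.  Extending maps along A/(X_l^N, l in L) --X_m--> the  *)
(* same module shows that X_m, m not in L, is surjective on C_L(E).  Hence the  *)
(* cohomology of C_(m, L)(E) is obtained from that of C_L(E) by taking the      *)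
(* kernel and the cokernel of H -> H_(X_m).  Adding X_n, ..., X_1 one after the *)
(* other, the k-th complex has H^k with K-basis the exponents whose last k      *)
(* entries are negative and whose other entries are the exponents of a monomial *)
(* outside the saturation of I by X_n, ..., X_(n-k+1).  Weak stability makes    *)
(* the X_(n-k)-torsion of this H^k torsion for all remaining variables, so it   *)
(* survives unchanged to the last complex, whose cohomology is H_m(A/I).  The   *)
(* resulting basis depends only on the monomials in I.                          *)
From HB Require Import structures.
Require Import Defs.
From mathcomp Require Import all_boot all_order all_algebra.
From mathcomp Require Import boolp zify.
From mathcomp Require Import mpoly.

Set Implicit Arguments.
Unset Strict Implicit.
Unset Printing Implicit Defensive.

Import Order.TTheory GRing.Theory Num.Theory.
Local Open Scope ring_scope.

(** Each graded piece of the local cohomology has a basis indexed by a finite set of integer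
    exponents, cut out by inequalities against the exponents in [G] alone. Over both fields the
    Hilbert function counts this same set. Let C_L be the subcomplex of L-torsion elements of an
    injective resolution, with cohomology H. For m outside L, [injective_div] makes X_m surjective
    on C_L, so 0 -> C_(m, L) -> C_L -> (C_L)_(X_m) -> 0 is exact. Hence H^i of C_(m, L) is an
    extension of the kernel of H^i -> H^i_(X_m) by the cokernel of H^(i-1) -> H^(i-1)_(X_m). The
    extension is only needed when one side vanishes: [presented_torsion] treats a vanishing
    cokernel, [presented_quotient] the case H^i = 0. Weak stability guarantees that one of the two
    cases always occurs. [weakly_stable_regular] turns it into [eventually_regular], a condition on
    exponents without any field, and [stage_torsion_bound] deduces a bound on nonnegative exponents.
    So every class below the top degree is killed by powers of all variables still to be added
    ([cohomology_index_nilp]). The induction over the variables, [presented_cohomology], starts from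
    A/I in [presented_aug]; [lc_dim_presented] then reads off dimensions. *)

(** * Integer exponent vectors *)

Section Exponents.
Variable n : nat.
Local Notation Zn := {ffun 'I_n -> int}.
Implicit Types (a b : Zn) (l m : 'I_n) (S : Zn -> Prop).

Definition up l (z : int) a : Zn := [ffun k => a k + (if k == l then z else 0)].
Definition tdeg a : int := \sum_l a l.
Definition le_exp a b : Prop := forall l, a l <= b l.
(** Convexity lets [X_l ^+ N] act on basis elements in one jump: if an exponent and its N-fold shift
    both lie in S, so do all the shifts in between. *)
Definition convex S : Prop :=
  forall a b c, S a -> S c -> le_exp a b -> le_exp b c -> S b.

Lemma up_up l z z' a : up l z (up l z' a) = up l (z' + z) a.
Proof. by apply/ffunP=> k; rewrite !ffunE; case: eqP => _; lia. Qed.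

Lemma up0 l a : up l 0 a = a.
Proof. by apply/ffunP=> k; rewrite !ffunE if_same addr0. Qed.

Lemma upC l l' z z' a : up l z (up l' z' a) = up l' z' (up l z a).
Proof. by apply/ffunP=> k; rewrite !ffunE addrAC. Qed.

Lemma upE l z a : up l z a l = a l + z.
Proof. by rewrite ffunE eqxx. Qed.

Lemma up_neq l z a k : k != l -> up l z a k = a k.
Proof. by rewrite ffunE => /negPf->; rewrite addr0. Qed.

Lemma tdeg_up l z a : tdeg (up l z a) = tdeg a + z.
Proof.
rewrite /tdeg; under eq_bigr do rewrite ffunE.
by rewrite big_split /= -big_mkcond /= big_pred1_eq.
Qed.

Lemma up_upK l z a : up l (- z) (up l z a) = a.
Proof. by rewrite up_up subrr up0. Qed.

Lemma up_upKV l z a : up l z (up l (- z) a) = a.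
Proof. by rewrite up_up addNr up0. Qed.

Lemma le_exp_up l z a : 0 <= z -> le_exp a (up l z a).
Proof. by move=> z0 k; rewrite ffunE; case: eqP => _; lia. Qed.

Lemma le_up_exp l z a : z <= 0 -> le_exp (up l z a) a.
Proof. by move=> z0 k; rewrite ffunE; case: eqP => _; lia. Qed.

Lemma le_up2 l z z' a b :
  z <= z' -> le_exp a b -> le_exp (up l z a) (up l z' b).
Proof. by move=> zz ab k; rewrite !ffunE; have := ab k; case: eqP => _; lia. Qed.

End Exponents.

(** * Elements killed by powers of chosen variables *)

Section VarTorsion.
Variables (K : fieldType) (n : nat).
Implicit Types (M : gradedModule K n) (L : {set 'I_n}) (l : 'I_n).

Definition var_torsion L M (x : M) : Prop :=
  forall l, l \in L -> exists N, 'X_l ^+ N *: x = 0.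

Lemma expX_leq M l N N' (x : M) :
  (N <= N')%N -> 'X_l ^+ N *: x = 0 -> 'X_l ^+ N' *: x = 0.
Proof. by move=> /subnK <- h; rewrite exprD -scalerA h scaler0. Qed.

Lemma expX_homog l N : ('X_l ^+ N : {mpoly K[n]}) \is N.-homog.
Proof.
by rewrite mpolyXn dhomogX /= mdegMn mdeg1 mul1n.
Qed.

Lemma scaleXC M l (f : {mpoly K[n]}) (x : M) N :
  'X_l ^+ N *: (f *: x) = f *: ('X_l ^+ N *: x).
Proof. by rewrite !scalerA mulrC. Qed.

Lemma vt0 L M : var_torsion L (0 : M).
Proof. by move=> l _; exists 0%N; rewrite scaler0. Qed.

Lemma vtZ L M f (x : M) : var_torsion L x -> var_torsion L (f *: x).
Proof.
by move=> h l /h[N hN]; exists N; rewrite scaleXC hN scaler0.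
Qed.

Lemma vtD L M (x y : M) :
  var_torsion L x -> var_torsion L y -> var_torsion L (x + y).
Proof.
move=> hx hy l lL; have [N hN] := hx l lL; have [N' hN'] := hy l lL.
exists (N + N')%N; rewrite scalerDr.
by rewrite (expX_leq _ hN) ?leq_addr // (expX_leq _ hN') ?leq_addl ?addr0.
Qed.

Lemma vtN L M (x : M) : var_torsion L x -> var_torsion L (- x).
Proof. by rewrite -scaleN1r; apply: vtZ. Qed.

Lemma vtB L M (x y : M) :
  var_torsion L x -> var_torsion L y -> var_torsion L (x - y).
Proof. by move=> hx hy; apply: vtD => //; apply: vtN. Qed.

Lemma vt_sum L M (I : Type) (r : seq I) (F : I -> M) :
  (forall i, var_torsion L (F i)) -> var_torsion L (\sum_(i <- r) F i).
Proof. by move=> h; elim/big_ind: _ => //; [apply: vt0 | apply: vtD]. Qed.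

Lemma vt_gpart L M d (x : M) : var_torsion L x -> var_torsion L (gpart d x).
Proof.
move=> h l /h[N hN]; exists N.
by rewrite -(gpartZ _ _ (expX_homog l N)) hN gpart0.
Qed.

Lemma vt_linear L M M' (f : {linear M -> M'}) (x : M) :
  var_torsion L x -> var_torsion L (f x).
Proof. by move=> h l /h[N hN]; exists N; rewrite -linearZ hN linear0. Qed.

Lemma vt_setU1 L l M (x : M) N :
  'X_l ^+ N *: x = 0 -> var_torsion L x -> var_torsion (l |: L) x.
Proof. by move=> h hx k /setU1P[->|/hx //]; exists N. Qed.

Lemma vt_sub L L' M (x : M) :
  L \subset L' -> var_torsion L' x -> var_torsion L x.
Proof. by move=> /subsetP s h l /s /h. Qed.

Lemma vt_uniform L M (x : M) : var_torsion L x ->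
  exists N, forall l, l \in L -> 'X_l ^+ N *: x = 0.
Proof.
move=> h; have /choice[N hN] : forall l, exists N,
    l \in L -> 'X_l ^+ N *: x = 0.
  by move=> l; case: (boolP (l \in L)) => [/h[N]|_]; [exists N|exists 0%N].
exists (\max_l N l)%N => l lL.
by apply: expX_leq (hN l lL); apply: (leq_bigmax l).
Qed.

End VarTorsion.

(** * Cohomology of the torsion subcomplexes with a basis of exponents *)

Section Presentations.
Variables (K : fieldType) (n : nat) (E : nat -> gradedModule K n).
Variable d : forall p, {linear E p -> E p.+1}.
Hypothesis dE : forall p, degree0 (d p).
Hypothesis dd : forall p x, d p.+1 (d p x) = 0.
Local Notation Zn := {ffun 'I_n -> int}.
Implicit Types (L : {set 'I_n}) (l m : 'I_n) (S : Zn -> Prop) (f g : Zn -> K).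

Definition cocycle L i (z : E i) : Prop := var_torsion L z /\ d i z = 0.

Definition coboundary L i : E i -> Prop :=
  match i with
  | 0 => fun z => z = 0
  | i'.+1 => fun z => exists2 y, var_torsion L y & z = d i' y
  end.

Lemma coboundary0 L i : coboundary L (0 : E i).
Proof.
by case: i => [|i] //=; exists 0; rewrite ?linear0 //; apply: vt0.
Qed.

Lemma coboundary_cocycle L i (z : E i) : coboundary L z -> cocycle L z.
Proof.
case: i z => [|i] z /=; first by move->; split; [apply: vt0|apply: linear0].
by case=> y hy ->; split; rewrite ?dd //; apply: vt_linear.
Qed.

Lemma coboundary_sub L L' i (z : E i) :
  L \subset L' -> coboundary L' z -> coboundary L z.
Proof.
by case: i z => [|i] z //= s [y hy ->]; exists y => //; apply: vt_sub hy.
Qed.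

Lemma cocycleD L i (y z : E i) : cocycle L y -> cocycle L z -> cocycle L (y + z).
Proof.
by move=> [? ?] [? ?]; split; [apply: vtD|rewrite linearD /= -[RHS]addr0; congr (_ + _)].
Qed.

Lemma cocycleZ L i c (z : E i) : cocycle L z -> cocycle L (c *: z).
Proof. by move=> [? h]; split; [apply: vtZ|rewrite linearZ /= h scaler0]. Qed.

(* The relation R exhibits the i-th cohomology of the subcomplex of torsion   *)
(* elements for the variables in L as the K-space with basis (e_a), a in S,   *)
(* on which X_l sends e_a to e_(a + l) if a + l is in S and to 0 otherwise.   *)
Record presentation L i S (R : E i -> (Zn -> K) -> Prop) : Prop := {
  pres_cocycle : forall z f, R z f -> cocycle L z;
  pres_supp : forall z f a, R z f -> f a != 0 -> S a;
  pres_fin : forall z f, R z f -> exists s : seq Zn, forall a, f a != 0 -> a \in s;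
  pres_lin : forall c y z f g, R y f -> R z g ->
    R (c%:MP *: y + z) (fun a => c * f a + g a);
  pres_var : forall l z f, R z f ->
    R ('X_l *: z) (fun a => if `[< S a >] then f (up l (-1) a) else 0);
  pres_ker : forall z f, R z f -> (forall a, f a = 0) <-> coboundary L z;
  pres_total : forall z, cocycle L z -> exists f, R z f;
  pres_surj : forall f, (exists s : seq Zn, forall a, f a != 0 -> a \in s) ->
    (forall a, f a != 0 -> S a) -> exists z, R z f;
  pres_deg : forall j z f, R z f ->
    R (gpart j z) (fun a => if tdeg a == j then f a else 0)
}.

Definition presented L i S : Prop :=
  exists R : E i -> (Zn -> K) -> Prop, presentation L S R.

Lemma eq_presented L i S S' : (forall a, S a <-> S' a) ->
  presented L i S -> presented L i S'.
Proof.
move=> h; suff -> : S' = S by [].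
by apply/funext => a; apply/propext; split=> /h.
Qed.

Lemma presented_empty L i : (forall z : E i, cocycle L z -> coboundary L z) ->
  presented L i (fun _ => False).
Proof.
move=> hz; exists (fun z f => cocycle L z /\ forall a, f a = 0).
split.
- by move=> z f [].
- by move=> z f a [_ ->]; rewrite eqxx.
- by move=> z f [_ h]; exists [::] => a; rewrite h eqxx.
- move=> c y z f g [hy hf] [hz' hg]; split=> [|a]; last by rewrite hf hg mulr0 addr0.
  by apply: cocycleD => //; apply: cocycleZ.
- by move=> l z f [h hf]; split=> [|a]; [apply: cocycleZ|rewrite hf if_same].
- by move=> z f [h hf]; split=> // _; apply: hz.
- by move=> z h; exists (fun _ => 0).
- move=> f _ h; exists 0; split=> [|a]; first exact/coboundary_cocycle/coboundary0.
  by case: (eqVneq (f a) 0) => // /h.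
- move=> j z f [[h1 h2] hf]; split=> [|a]; last by rewrite hf if_same.
  by split; [apply: vt_gpart|rewrite dE h2 gpart0].
Qed.

Lemma presented_emptyE L i : presented L i (fun _ => False) ->
  forall z : E i, cocycle L z -> coboundary L z.
Proof.
move=> [R hR] z /(pres_total hR)[f hf]; apply/(pres_ker hR hf) => a.
by case: (eqVneq (f a) 0) => // /(pres_supp hR hf).
Qed.

Section PresentationTheory.
Variables (L : {set 'I_n}) (i : nat) (S : Zn -> Prop).
Variables (R : E i -> (Zn -> K) -> Prop) (hR : presentation L S R).

Lemma pres_eq z f g : R z f -> (forall a, f a = g a) -> R z g.
Proof. by move=> h /funext <-. Qed.

Lemma pres_sub y z f g : R y f -> R z g -> R (y - z) (fun a => f a - g a).
Proof.
move=> hy hz; have := pres_lin hR (-1) hz hy.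
rewrite !rmorphN rmorph1 scaleN1r addrC => /pres_eq; apply=> a.
by rewrite mulN1r addrC.
Qed.

Lemma pres_coboundary z : coboundary L z -> R z (fun _ => 0).
Proof.
move=> hz; have [f hf] := pres_total hR (coboundary_cocycle hz).
by apply: (pres_eq hf); apply/(pres_ker hR hf).
Qed.

Lemma pres0 : R 0 (fun _ => 0).
Proof. exact/pres_coboundary/coboundary0. Qed.

Lemma pres_fun z f g : R z f -> R z g -> forall a, f a = g a.
Proof.
move=> hf hg a; have := pres_sub hf hg; rewrite subrr => h.
by apply/eqP; rewrite -subr_eq0; apply/eqP; move: a; apply/(pres_ker hR h)/coboundary0.
Qed.

Lemma pres_sum (I : Type) (r : seq I) (c : I -> K) (F : I -> E i)
    (G : I -> Zn -> K) : (forall k, R (F k) (G k)) ->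
  R (\sum_(k <- r) (c k)%:MP *: F k) (fun a => \sum_(k <- r) c k * G k a).
Proof.
move=> h; elim: r => [|k r IH].
  by rewrite big_nil; apply: (pres_eq pres0) => a; rewrite big_nil.
rewrite big_cons; apply: (pres_eq (pres_lin hR _ (h k) IH)) => a.
by rewrite big_cons.
Qed.

Hypothesis cS : convex S.

Lemma pres_varX l N z f : R z f ->
  R ('X_l ^+ N *: z)
    (fun a => if `[< S a >] then f (up l (- N%:Z) a) else 0).
Proof.
move=> h; elim: N => [|N IH].
  rewrite expr0 scale1r; apply: (pres_eq h) => a; rewrite up0.
  case: asboolP => // nS; apply/eqP/negPn/negP => /(pres_supp hR h); exact: nS.
rewrite exprS -scalerA; apply: (pres_eq (pres_var hR l IH)) => a.
rewrite up_up -opprD -PoszD add1n.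
case: asboolP => // Sa; case: asboolP => // nS.
apply/esym/eqP/negPn/negP => /(pres_supp hR h) Sb; apply: nS.
by apply: cS Sb Sa _ _; [apply: le_up2 => //; lia | apply: le_up_exp; lia].
Qed.

Lemma pres_varX0 l N z f a : R z f -> 'X_l ^+ N *: z = 0 -> S (up l N%:Z a) ->
  f a = 0.
Proof.
move=> h h0 Sa; have := pres_varX l N h; rewrite h0 => /pres_fun /(_ pres0).
by move=> /(_ (up l N%:Z a)); rewrite asboolT // up_upK.
Qed.

(** The support of [f] is finite, so the largest of the exponents that push its elements out of S
    serves for all of them; by convexity nothing re-enters S later. *)
Lemma pres_nilp l z f : R z f ->
  (forall a, f a != 0 -> exists N : nat, ~ S (up l N%:Z a)) ->
  exists N, coboundary L ('X_l ^+ N *: z).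
Proof.
move=> hf hS; have [s hs] := pres_fin hR hf.
have /choice[N hN] : forall a, exists N : nat, f a != 0 -> ~ S (up l N%:Z a).
  move=> a; case: (eqVneq (f a) 0) => [_|/hS[N]]; last by exists N.
  by exists 0%N.
exists (\max_(a <- s) N a)%N.
apply/(pres_ker hR (pres_varX l _ hf)) => a; case: asboolP => // Sa.
set b := up _ _ a; apply/eqP/negPn/negP => fb.
have Sb := pres_supp hR hf fb; have bs := hs _ fb.
apply: (hN b fb); apply: cS Sb Sa _ _; first by apply: le_exp_up; lia.
have le : (N b <= \max_(a <- s) N a)%N by apply: leq_bigmax_seq.
by rewrite up_up; apply: le_up_exp; lia.
Qed.

End PresentationTheory.

(** * Passing from L-torsion to torsion for one more variable *)

Section AddVariable.
Variables (L : {set 'I_n}) (m : 'I_n).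
(** Divisibility makes the localization map from C_L to (C_L)_(X_m) surjective; its kernel is the
    complex for [m |: L]. *)
Hypothesis divX : forall p (x : E p), var_torsion L x ->
  exists2 y, var_torsion L y & 'X_m *: y = x.

Lemma divXn N p (x : E p) : var_torsion L x ->
  exists2 y, var_torsion L y & 'X_m ^+ N *: y = x.
Proof.
move=> hx; elim: N => [|N [y hy <-]]; first by exists x; rewrite // scale1r.
by have [w hw <-] := divX hy; exists w; rewrite // exprSr scalerA.
Qed.

Lemma coboundary_div N i (z : E i) : coboundary L z ->
  exists2 w, coboundary L w & 'X_m ^+ N *: w = z.
Proof.
case: i z => [|i] z /=; first by move=> ->; exists 0; rewrite ?scaler0.
case=> y /(divXn N)[w hw <-] ->; exists (d i w); last by rewrite linearZ.
by exists w.
Qed.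

(** The correction used throughout: when ['X_m ^+ N *: y] is a coboundary, [coboundary_div] supplies
    such a [w], and [y - w] has moved into the smaller complex without changing its differential. *)
Lemma vt_lift N i (y w : E i) : var_torsion L y -> coboundary L w ->
  'X_m ^+ N *: y = 'X_m ^+ N *: w -> var_torsion (m |: L) (y - w).
Proof.
move=> hy /coboundary_cocycle[hw _] e; apply: (@vt_setU1 _ _ _ _ _ _ N); last exact: vtB.
by rewrite scalerBr e subrr.
Qed.

(** Every class one degree lower is killed by a power of X_m, so its localization vanishes and
    contributes no cokernel. What remains is the kernel of H^i -> H^i_(X_m): the exponents that
    leave S when the m-th entry is raised. *)
Lemma presented_torsion i S : convex S ->
  (if i is i'.+1 then forall y : E i', cocycle L y ->
     exists N, coboundary L ('X_m ^+ N *: y) else True) ->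
  presented L i S ->
  presented (m |: L) i (fun a => S a /\ exists N : nat, ~ S (up m N%:Z a)).
Proof.
move=> cS hnil [R hR].
have sub : L \subset m |: L by apply: subsetUr.
(* Injectivity into H^i of C_L. If z = d y and ['X_m ^+ N] kills z, then ['X_m ^+ N *: y] is a
   cocycle one degree lower, hence a coboundary after a further power of X_m; dividing back corrects
   y to an X_m-torsion element. *)
have bnd (z : E i) : cocycle (m |: L) z -> coboundary L z -> coboundary (m |: L) z.
  case: i S cS hnil R hR z => [|i] S cS hnil R hR z //= [hz dz] [y hy zE].
  have [N hN] := hz m (setU11 _ _).
  have cy : cocycle L ('X_m ^+ N *: y).
    by split; [apply: vtZ|rewrite linearZ /= -zE].
  have [N' /(coboundary_div (N' + N))[w hw wE]] := hnil _ cy.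
  exists (y - w); first by apply: (vt_lift (N := N' + N)); rewrite // wE exprD scalerA.
  by rewrite linearB /= (coboundary_cocycle hw).2 subr0.
exists (fun z f => cocycle (m |: L) z /\ R z f).
have supp z f a : cocycle (m |: L) z -> R z f -> f a != 0 ->
    S a /\ exists N : nat, ~ S (up m N%:Z a).
  move=> [hz _] h fa; split; first exact: (pres_supp hR h fa).
  have [N hN] := hz m (setU11 _ _); exists N => Sa.
  by case/eqP: fa; exact: (pres_varX0 hR cS h hN Sa).
split.
- by move=> z f [].
- by move=> z f a [hz h]; apply: supp h.
- by move=> z f [_ /(pres_fin hR)].
- move=> c y z f g [hy h] [hz h']; split; last exact: (pres_lin hR _ h h').
  by apply: cocycleD => //; apply: cocycleZ.
- move=> l z f [hz h]; split; first exact: cocycleZ.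
  apply: (pres_eq (pres_var hR l h)) => a.
  case: asboolP => Sa; last by rewrite asboolF // => -[].
  case: asboolP => // nS; apply/eqP/negPn/negP => /(supp _ _ _ hz h)[Sb [N hN]].
  apply: nS; split=> //; exists N => Sc; apply: hN; apply: cS Sb Sc _ _.
    by apply: le_exp_up; lia.
  by apply: le_up2 => //; apply: le_up_exp; lia.
- move=> z f [hz h]; split=> [/(pres_ker hR h)|/(coboundary_sub sub)]; first exact: bnd.
  by move=> /(pres_ker hR h).
- move=> z hz; have [|f hf] := pres_total hR (z := z); last by exists f.
  by case: hz => hz dz; split=> //; apply: vt_sub hz.
(* A power of X_m turns z into a coboundary; subtracting the divided coboundary w keeps the class
   and makes the representative X_m-torsion. *)
- move=> f hfin hf; have [z hz] := pres_surj hR hfin (fun a fa => (hf a fa).1).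
  have [N hN] := pres_nilp hR cS hz (fun a fa => (hf a fa).2).
  have [w hw wE] := coboundary_div N hN.
  exists (z - w); split.
    have [hz1 hz2] := pres_cocycle hR hz; have [hw1 hw2] := coboundary_cocycle hw.
    by split; [apply: (vt_lift (N := N)) | rewrite linearB /= hz2 hw2 subr0].
  apply: (pres_eq (pres_sub hR hz (pres_coboundary hR hw))) => a.
  by rewrite subr0.
- move=> j z f [[h1 h2] h]; split; last exact: (pres_deg hR _ h).
  by split; [apply: vt_gpart|rewrite dE h2 gpart0].
Qed.

(* S' indexes the cokernel of H -> H_(X_m) when S indexes H.                  *)
Lemma presented_quotient i S S' : convex S ->
  (forall a, S a -> 0 <= a m) ->
  (forall a (N : nat), S a -> N%:Z <= a m -> S (up m (- N%:Z) a)) ->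
  (forall b, S' b <->
     b m < 0 /\ forall N : nat, 0 <= b m + N%:Z -> S (up m N%:Z b)) ->
  presented L i S -> presented L i.+1 (fun _ => False) ->
  presented (m |: L) i.+1 S'.
Proof.
move=> cS S0 S1 S'E [R hR] /presented_emptyE hnext.
(* The connecting map: y lifts the fraction f / X_m^N, so [d i y] represents its image, whose
   coefficient at b is that of f at b shifted up by N. *)
pose R' z' f' := exists y N f, [/\ var_torsion L y, z' = d i y,
  R ('X_m ^+ N *: y) f & f' = fun b => if `[< S' b >] then f (up m N%:Z b) else 0].
exists R'.
(* Enlarging the denominator leaves the coefficients on S' unchanged, so fractions can be brought to
   a common one. *)
have raise y N f N' : R ('X_m ^+ N *: y) f -> exists f2,
    [/\ R ('X_m ^+ (N' + N) *: y) f2,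
      forall b, S' b -> f2 (up m (N' + N)%N%:Z b) = f (up m N%:Z b) &
      forall a, f2 a = if `[< S a >] then f (up m (- N'%:Z) a) else 0].
  move=> h; exists (fun a => if `[< S a >] then f (up m (- N'%:Z) a) else 0).
  split=> [|b /S'E[b0 hb]|//].
    by rewrite exprD -scalerA; exact: (pres_varX hR cS m N' h).
  rewrite up_up; have -> : (N' + N)%N%:Z - N'%:Z = N%:Z by lia.
  case: asboolP => // nS; apply/esym/eqP/negPn/negP => /(pres_supp hR h) Sb.
  by apply: nS; apply: hb; have := S0 _ Sb; rewrite upE; lia.
(* A sufficiently large denominator also kills the X_m-torsion part of the numerator. *)
have nontors y N f : R ('X_m ^+ N *: y) f -> exists N2 f2,
    [/\ R ('X_m ^+ N2 *: y) f2,
      forall b, S' b -> f2 (up m N2%:Z b) = f (up m N%:Z b) &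
      forall c, f2 c != 0 -> forall M : nat, S (up m M%:Z c)].
  move=> h; have [s hs] := pres_fin hR h.
  have /choice[N' hN] : forall a, exists N' : nat,
      (exists M : nat, ~ S (up m M%:Z a)) -> ~ S (up m N'%:Z a).
    by move=> a; case: (pselect (exists M : nat, ~ S (up m M%:Z a))) => [[M]|no];
      [exists M|exists 0%N].
  have [f2 [h1 h2 h3]] := raise _ _ _ (\max_(a <- s) N' a)%N h.
  exists (\max_(a <- s) N' a + N)%N, f2; split=> // c fc M.
  have Sc := pres_supp hR h1 fc.
  move: fc; rewrite h3 asboolT //; set b := up _ _ c => fb.
  have Sb := pres_supp hR h fb; have bs := hs _ fb.
  have le : (N' b <= \max_(a <- s) N' a)%N by apply: leq_bigmax_seq.
  have SN : S (up m (N' b)%:Z b).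
    apply: cS Sb Sc _ _; first by apply: le_exp_up; lia.
    by rewrite up_up; apply: le_up_exp; lia.
  apply: contrapT => nS; apply: (hN b) SN.
  exists (\max_(a <- s) N' a + M)%N; rewrite /b up_up.
  by have -> : - (\max_(a <- s) N' a)%N%:Z + (\max_(a <- s) N' a + M)%N%:Z = M%:Z by lia.
split.
- move=> z f [y [N [g [hy -> h _]]]]; split; last exact: dd.
  apply: (@vt_setU1 _ _ _ _ _ _ N); last exact: vt_linear.
  by have [_] := pres_cocycle hR h; rewrite linearZ.
- by move=> z f a [y [N [g [hy zE h ->]]]]; case: asboolP => //; rewrite eqxx.
- move=> z f [y [N [g [hy zE h ->]]]]; have [s hs] := pres_fin hR h.
  exists [seq up m (- N%:Z) a | a <- s] => b; case: asboolP; rewrite ?eqxx // => _ /hs hb.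
  by rewrite -(up_upK m N%:Z b) map_f.
- move=> c z1 z2 f1 f2 [y1 [N1 [g1 [hy1 -> h1 ->]]]] [y2 [N2 [g2 [hy2 -> h2 ->]]]].
  have [g1' [r1 e1 _]] := raise _ _ _ N2 h1; have [g2' [r2 e2 _]] := raise _ _ _ N1 h2.
  exists (c%:MP *: y1 + y2), (N1 + N2)%N, (fun a => c * g1' a + g2' a); split.
  + by apply: vtD => //; apply: vtZ.
  + by rewrite linearD linearZ.
  + rewrite scalerDr scaleXC; apply: (pres_lin hR) => //; rewrite addnC //.
  + apply/funext => b; case: asboolP => [Sb|_]; last by rewrite mulr0 addr0.
    by rewrite -e1 // -e2 // addnC.
- move=> l z f [y [N [g [hy -> h ->]]]]; exists ('X_l *: y), N.
  exists (fun a => if `[< S a >] then g (up l (-1) a) else 0); split.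
  + exact: vtZ.
  + by rewrite linearZ.
  + by rewrite scaleXC; apply: (pres_var hR).
  + apply/funext => b; case: asboolP => // S'b; have [b0 hb] := (S'E b).1 S'b.
    rewrite (upC l m); set c := up m N%:Z _.
    case: (eqVneq (g c) 0) => [->|gc]; first by rewrite !if_same.
    have Sc := pres_supp hR h gc.
    have c0 : 0 <= up l (-1) b m + N%:Z by have := S0 _ Sc; rewrite upE.
    have le1 : up l (-1) b m <= b m by rewrite ffunE; case: eqP => _; lia.
    rewrite !asboolT //; first by apply: hb; lia.
    apply/S'E; split=> [|N' hN']; first by lia.
    case: (leqP N N') => NN.
      apply: (cS c _ (up m N'%:Z b)) => //; first by apply: hb; lia.
        by apply: le_up2 => //; lia.
      by apply: le_up2 => //; apply: le_up_exp; lia.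
    have := S1 c (N - N')%N Sc; rewrite /c up_up upE.
    have -> : N%:Z - (N - N')%N%:Z = N'%:Z by lia.
    by apply; lia.
- move=> z f [y [N [g [hy zE h fE]]]]; split.
  + move=> f0; have [N2 [g2 [r2 e2 n2]]] := nontors _ _ _ h.
    (* An index c of the torsion-free numerator with m-th entry below N2 would come from an element
       of S', where f vanishes. Hence the numerator is ['X_m ^+ N2] times a class y0 of H, and y -
       y0 is X_m-torsion up to a coboundary. *)
    have g2N c : g2 c != 0 -> N2%:Z <= c m.
      move=> gc; rewrite leNgt; apply/negP => cN.
      have Sc := pres_supp hR r2 gc.
      have c0 := S0 _ Sc.
      have S'c : S' (up m (- N2%:Z) c).
        apply/S'E; rewrite upE; split=> [|M hM]; first by lia.
        rewrite up_up; case: (leqP N2 M) => NM.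
          by have -> : - N2%:Z + M%:Z = (M - N2)%N%:Z by [lia]; apply: n2.
        have -> : - N2%:Z + M%:Z = - (N2 - M)%N%:Z by lia.
        by apply: S1 => //; lia.
      have := f0 (up m (- N2%:Z) c); rewrite fE asboolT // -e2 // up_upKV.
      exact/eqP.
    have [s hs] := pres_fin hR r2.
    have [||y0 hy0] := pres_surj hR
        (f := fun a => if `[< S a >] then g2 (up m N2%:Z a) else 0).
    * exists [seq up m (- N2%:Z) a | a <- s] => b.
      case: asboolP; rewrite ?eqxx // => _ /hs hb.
      by rewrite -(up_upK m N2%:Z b) map_f.
    * by move=> a; case: asboolP; rewrite ?eqxx.
    have := pres_sub hR r2 (pres_varX hR cS m N2 hy0).
    rewrite -scalerBr => hd.
    have /(pres_ker hR hd) : forall a, g2 a - (if `[< S a >] then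
        if `[< S (up m (- N2%:Z) a) >] then g2 (up m N2%:Z (up m (- N2%:Z) a))
        else 0 else 0) = 0.
      move=> a; rewrite up_upKV; case: (eqVneq (g2 a) 0) => [->|ga].
        by rewrite !if_same subrr.
      have Sa := pres_supp hR r2 ga.
      by rewrite !asboolT ?subrr //; apply: S1 => //; apply: g2N.
    move=> /(coboundary_div N2)[w hw wE].
    have [hy0v hy0d] := pres_cocycle hR hy0.
    exists (y - y0 - w); first by apply: (vt_lift (N := N2)) => //; apply: vtB.
    by rewrite zE !linearB /= hy0d (coboundary_cocycle hw).2 !subr0.
  (* Conversely y differs from an X_m-torsion element by a cocycle, so the fraction comes from H,
     where no m-th entry is negative. *)
  + case=> y2 hy2 zE2 b; rewrite fE; case: asboolP => // S'b.
    have [b0 hb] := (S'E b).1 S'b.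
    have [N0 hN0] := hy2 m (setU11 _ _).
    have [g2 [r2 e2 _]] := raise _ _ _ N0 h.
    have cyc : cocycle L (y - y2).
      split; first by apply: vtB => //; apply: vt_sub hy2; apply: subsetUr.
      by rewrite linearB /= -zE -zE2 subrr.
    have [g3 h3] := pres_total hR cyc.
    have := pres_varX hR cS m (N0 + N) h3.
    rewrite scalerBr (expX_leq (leq_addr _ _) hN0) subr0 => h4.
    rewrite -e2 // (pres_fun hR r2 h4) up_upK; case: asboolP => // _.
    by apply/eqP/negPn/negP => /(pres_supp hR h3)/S0; lia.
- move=> z [hz dz].
  have [y hy zE] : coboundary L z.
    by apply: hnext; split=> //; apply: vt_sub hz; apply: subsetUr.
  have [N hN] := hz m (setU11 _ _).
  have [|g hg] := pres_total hR (z := 'X_m ^+ N *: y).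
    by split; [apply: vtZ|rewrite linearZ /= -zE].
  by eexists; exists y, N, g; split.
- move=> f [s hs] hf.
  (* A common denominator: shifting by N makes every m-th entry in the support nonnegative, hence
     lands in S. *)
  pose N := (\max_(b <- s) `|b m|)%N.
  have fN b : f b != 0 -> 0 <= b m + N%:Z.
    move=> /hs bs; have : (`|b m| <= N)%N.
      by apply: (@leq_bigmax_seq _ s xpredT (fun b : Zn => `|b m|%N)).
    lia.
  have [||z hz] := pres_surj hR (f := fun a => f (up m (- N%:Z) a)).
  + exists [seq up m N%:Z b | b <- s] => a /hs hb.
    by rewrite -(up_upKV m N%:Z a) map_f.
  + move=> a fa; have := fN _ fa; have /S'E[_ hb] := hf _ fa.
    by move=> /hb; rewrite up_upKV.
  have [y hy yE] := divXn N (pres_cocycle hR hz).1.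
  exists (d i y), y, N, (fun a => f (up m (- N%:Z) a)); split; rewrite ?yE //.
  apply/funext => b; rewrite up_upK; case: asboolP => // nS.
  by apply/eqP/negPn/negP => /hf.
- move=> j z f [y [N [g [hy -> h ->]]]].
  exists (gpart j y), N, (fun a => if tdeg a == j + N%:Z then g a else 0); split.
  + exact: vt_gpart.
  + by rewrite dE.
  + by rewrite -(gpartZ _ _ (expX_homog _ m N)); apply: (pres_deg hR).
  + apply/funext => b; rewrite tdeg_up (inj_eq (addIr _)).
    by case: eqP => _ //; rewrite if_same.
Qed.

End AddVariable.

End Presentations.

(** * Membership in monomial ideals *)

Section MonomialIdeals.
Variables (K : fieldType) (n : nat).
Implicit Types (G : 'X_{1..n} -> Prop) (u g : 'X_{1..n}) (p : {mpoly K[n]}).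

Lemma mcoeffM_X p g u :
  (p * 'X_[g])@_u = if (g <= u)%MM then p@_(u - g)%MM else 0.
Proof.
case: ifP => [gu|ngu]; first by rewrite -{1}(submK gu) addmC mcoeffMX.
apply/eqP; rewrite mcoeff_eq0 (perm_mem (msuppMX _ _)).
by apply/negP => /mapP[v _ uE]; rewrite uE lem_addr in ngu.
Qed.

Lemma mem_monomial_ideal G p :
  p \in monomial_ideal K G <->
  forall u, u \in msupp p -> exists2 g, G g & (g <= u)%MM.
Proof.
split.
  move=> /asboolP[s hs ->] u; rewrite mcoeff_msupp raddf_sum /=.
  apply: contra_neqP => no; rewrite big_seq; apply: big1 => q qs.
  have [[g Gg ->] _] := hs q qs; rewrite mcoeffM_X; case: ifP => // gu.
  by case: no; exists g.
move=> h; rewrite [p]mpolyE big_seq; apply: rpred_sum => u /h[g Gg gu].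
rewrite -mul_mpolyC -(submK gu) mpolyXD mulrA.
apply: ((rpredZ (V := gpoly K n))); apply/asboolP; exists [:: (1, 'X_[g])].
  move=> q; rewrite inE => /eqP -> /=; split; first by exists g.
  exists (mdeg g)%:Z; rewrite /homogeneous_of /= pihomog_dE //.
  by rewrite dhomogX.
by rewrite big_seq1 scale1r.
Qed.

Lemma lmod_pi_eq0 (R : nzRingType) (V : lmodType R) (S : submodClosed V) (x : V) :
  lmod_pi S x = 0 <-> x \in S.
Proof.
have -> : 0 = lmod_pi S 0 by rewrite raddf0.
by rewrite -{2}[x]subr0; split=> /lmod_piP.
Qed.

End MonomialIdeals.

Lemma linear_exists (R : pzRingType) (U V : lmodType R) (f : U -> V) :
  linear f -> exists g : {linear U -> V}, g =1 f.
Proof.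
move=> hf; pose g : {linear U -> V} := HB.pack f (GRing.isLinear.Build _ _ _ _ f hf).
by exists g.
Qed.

(** * Twists, and divisibility of graded injective modules *)

Section Shift.
Variables (K : fieldType) (n : nat) (M : gradedModule K n) (s : int).

Definition gshift_part (j : int) (x : M) : M := gpart (j + s) x.

Fact gshift_partB j x y : gshift_part j (x - y) = gshift_part j x - gshift_part j y.
Proof. exact: gpartB. Qed.

Fact gshift_part_part j e x :
  gshift_part j (gshift_part e x) = if j == e then gshift_part e x else 0.
Proof. by rewrite /gshift_part gpart_gpart (inj_eq (addIr _)). Qed.

Fact gshift_part_sum x : exists2 r : seq int,
  uniq r & x = \sum_(j <- r) gshift_part j x.
Proof.
have [r ur xE] := gpart_sum x; exists [seq j - s | j <- r].
  by rewrite map_inj_uniq //; apply: addIr.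
by rewrite big_map {1}xE; apply: eq_bigr => j _; rewrite /gshift_part subrK.
Qed.

Fact gshift_partZ j (e : nat) f x : f \is e.-homog ->
  gshift_part (j + e%:Z) (f *: x) = f *: gshift_part j x.
Proof. by move=> hf; rewrite /gshift_part addrAC gpartZ. Qed.

Definition gshift : gradedModule K n :=
  GradedModule gshift_partB gshift_part_part gshift_part_sum gshift_partZ.

End Shift.

Section InjectiveDivisible.
Variables (K : fieldType) (n : nat).
Implicit Types (M E : gradedModule K n) (L : {set 'I_n}).

Lemma gpart_scale M (x : M) (j k : int) (p : {mpoly K[n]}) :
  homogeneous_of j x ->
  gpart k (p *: x) = (gpoly_part (k - j) p : {mpoly K[n]}) *: x.
Proof.
move=> hx; set N := maxn (mmeasure mdeg p) `|k - j|.+1.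
have -> : gpart k (p *: x) =
    \sum_(i < N) if k - j == i%:Z then pihomog mdeg i p *: x else 0.
  rewrite {1}(pihomog_partitionE (mf := mdeg) (p := p) (leq_maxl _ `|k - j|.+1)) -/N.
  rewrite scaler_suml gpart_bigsum; apply: eq_bigr => i _.
  rewrite -[k in LHS](subrK i%:Z) gpartZ ?pihomogP // -hx gpart_gpart.
  have -> : (k - i%:Z == j) = (k - j == i%:Z) by apply/eqP/eqP; lia.
  by case: ifP => // _; rewrite ?scaler0 ?hx.
case kE: (k - j) => [i|i] /=; last by rewrite big1 ?scale0r.
have lt : (i < N)%N by rewrite /N kE leq_max ltnS leqnn orbT.
rewrite (bigD1 (Ordinal lt)) //= eqxx big1 ?addr0 // => i' ni.
by case: eqP => // -[iE]; case/eqP: ni; apply: val_inj.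
Qed.

(** Since x is killed by the ideal I of all ['X_l ^+ N] with l in L, 1 -> x defines a map on Q = A/I
    twisted so that 1 has degree j. Extending it along the injective multiplication by X_m on Q, the
    image of 1 in the target is the required y. *)
Lemma injective_div_homog E L m j (x : E) : graded_injective E -> m \notin L ->
  homogeneous_of j x -> var_torsion L x ->
  exists2 y, var_torsion L y & 'X_m *: y = x.
Proof.
move=> hE mL hx /vt_uniform[N hN].
pose G u := exists2 l, l \in L & u = (U_(l) *+ N)%MM.
pose I := monomial_ideal K G; pose Q := gquot I.
have Ix p : p \in I -> p *: x = 0.
  move=> /mem_monomial_ideal h; rewrite [p]mpolyE big_seq scaler_suml.
  apply: big1 => u /h[_ [l lL ->] lu].
  rewrite -mul_mpolyC -(submK lu) mpolyXD mulrA -scalerA.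
  by rewrite -mpolyXn hN ?scaler0.
have piE (p : gpoly K n) :
    (lmod_repr (lmod_pi I p) : {mpoly K[n]}) *: x = (p : {mpoly K[n]}) *: x.
  apply/eqP; rewrite -subr_eq0 -scalerBl; apply/eqP/Ix/lmod_piP.
  exact: lmod_reprK.
have [f fE] : exists f : {linear gshift Q (- j) -> E},
    f =1 fun q => (lmod_repr (q : Q) : {mpoly K[n]}) *: x.
  apply: linear_exists => a q q' /=.
  rewrite -[q]lmod_reprK -[q']lmod_reprK -linearP !piE.
  by rewrite scalerDl scalerA.
have [u uE] : exists u : {linear gshift Q (- j) -> gshift Q (- j + 1)},
    u =1 fun q => 'X_m *: (q : Q).
  apply: linear_exists => a q q' /=.
  by rewrite scalerDr !scalerA mulrC.
(* As m is not in L, a monomial times X_m is divisible by some X_l^N with l in L only if the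
   monomial already is. *)
have uinj : injective u.
  move=> q q' e; apply/eqP; rewrite -subr_eq0; apply/eqP.
  have {e} : 'X_m *: (q - q' : Q) = 0 by rewrite -uE linearB /= e subrr.
  rewrite -[q - q' : Q]lmod_reprK -linearZ /= => /lmod_pi_eq0/mem_monomial_ideal h.
  apply/lmod_pi_eq0/mem_monomial_ideal => v vp.
  have [|_ [l lL ->] lv] := h (v + U_(m))%MM.
    by rewrite mcoeff_msupp /GRing.scale /= mulrC addmC mcoeffMX -mcoeff_msupp.
  exists (U_(l) *+ N)%MM; first by exists l.
  apply/mnm_lepP => k; have /mnm_lepP/(_ k) := lv.
  rewrite mnmDE !mulmnE !mnmE; case: (eqVneq m k) => [<-|]; last by rewrite addn0.
  by case: eqP lL mL => // -> ->.
have [||g gdeg gE] := hE _ _ u f _ uinj.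
- move=> k q; rewrite !uE /= /gshift_part addrA.
  exact/esym/(@gpartZ _ _ Q (k - j) 1 'X_m q (expX_homog K m 1)).
- move=> k q; rewrite !fE /= -[q]lmod_reprK /gshift_part.
  by rewrite gquot_part_pi !piE (gpart_scale _ _ hx).
pose one : gshift Q (- j + 1) := lmod_pi I (1 : {mpoly K[n]}).
exists (g one).
  move=> l lL; exists N; rewrite -linearZ.
  suff -> : 'X_l ^+ N *: one = 0 by rewrite linear0.
  rewrite /one -linearZ /=; apply/lmod_pi_eq0/mem_monomial_ideal => v.
  rewrite /GRing.scale /= mulr1 mpolyXn msuppX inE => /eqP ->.
  by exists (U_(l) *+ N)%MM; [exists l | apply/mnm_lepP].
by rewrite -linearZ -[X in g X]uE gE fE piE scale1r.
Qed.

Lemma injective_div E L m (x : E) : graded_injective E -> m \notin L ->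
  var_torsion L x -> exists2 y, var_torsion L y & 'X_m *: y = x.
Proof.
move=> hE mL hx; have [s _ xE] := gpart_sum x.
have /choice[y hy] : forall j, exists y, var_torsion L y /\ 'X_m *: y = gpart j x.
  move=> j; have [||y] := @injective_div_homog E L m j (gpart j x) hE mL;
    last by exists y.
    by rewrite /homogeneous_of gpart_gpart eqxx.
  exact: vt_gpart.
exists (\sum_(j <- s) y j); first by apply: vt_sum => j; apply: (hy j).1.
by rewrite scaler_sumr xE; apply: eq_bigr => j _; apply: (hy j).2.
Qed.

Lemma prod_const0_homog N (s : seq {mpoly K[n]}) : size s = N ->
  (forall f, f \in s -> f@_0%MM = 0) ->
  forall u, u \in msupp (\prod_(f <- s) f) -> (N <= mdeg u)%N.
Proof.
elim: s N => [|f s IH] [|N] //= [sN] h u; rewrite big_cons.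
move=> /msuppM_le/allpairsP[[v w] /= [vf ws ->]]; rewrite mdegD -add1n leq_add //.
  rewrite lt0n mdeg_eq0; apply: contraTneq vf => ->.
  by rewrite mcoeff_msupp h ?mem_head ?eqxx.
by apply: IH ws => // g gs; apply: h; rewrite inE gs orbT.
Qed.

Lemma torsionE M (x : M) : torsion x <-> var_torsion setT x.
Proof.
split=> [[k hk] l _|/vt_uniform[N hN]].
  exists k; have := hk (nseq k 'X_l) (size_nseq _ _).
  rewrite big_nseq -Monoid.iteropE; apply.
  by move=> f /nseqP[-> _]; rewrite mcoeffX mnm1_eq0.
(* Pigeonhole: a monomial of degree above n * N has some exponent at least N. *)
exists (n * N).+1 => s sE hs; set p := \prod_(f <- s) f.
rewrite [p]mpolyE big_seq scaler_suml; apply: big1 => u /(prod_const0_homog sE hs) du.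
have [l lu] : exists l, (N <= u l)%N.
  apply/existsP; rewrite -[X in is_true X]negbK negb_exists; apply/negP => /forallP h.
  move: du; rewrite ltnNge mdegE; apply/negP/negPn.
  rewrite -[X in (_ <= X * _)%N]card_ord -sum_nat_const; apply: leq_sum => l _.
  by have := h l; rewrite -ltnNge => /ltnW.
have le : (U_(l) *+ N <= u)%MM.
  apply/mnm_lepP => k; rewrite mulmnE mnmE; case: eqP => [<-|_]; first by rewrite mul1n.
  by rewrite mul0n.
rewrite -mul_mpolyC -(submK le) mpolyXD mulrA -scalerA.
by rewrite -mpolyXn hN ?inE // scaler0.
Qed.

End InjectiveDivisible.

(** * The exponents indexing the cohomology *)

Section IndexSets.
Variables (n : nat) (G : 'X_{1..n} -> Prop).
Local Notation Zn := {ffun 'I_n -> int}.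
Implicit Types (a b : Zn) (l : 'I_n) (u g : 'X_{1..n}).

Definition in_ideal u : Prop := exists2 g, G g & (g <= u)%MM.

(** Only the entries before m are compared with [G]: the monomial they form lies outside the
    saturation of I by the variables X_l with l >= m (indices start at 0). The negative entries
    record the cokernels of localization taken so far. *)
Definition stage m a : Prop :=
  (forall l, (0 <= a l) = (l < m)%N) /\
  forall g, G g -> exists2 l : 'I_n, (l < m)%N & a l < (g l)%:Z.

(** The second clause ignores the entry m - 1 and so says that a power of X_(m-1) kills the basis
    element; [stage_torsionE] makes this precise. *)
Definition stage_torsion m a : Prop :=
  stage m a /\
  exists2 g, G g & forall l, (l < m.-1)%N -> (g l)%:Z <= a l.

(* Exponents indexing the i-th cohomology of the complex of elements torsion  *)
(* for the last k variables.                                                  *)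
Definition cohomology_index k i : Zn -> Prop :=
  if (i < k)%N then stage_torsion (n - i)
  else if i == k then stage (n - i) else fun _ => False.

Lemma stage_convex m : convex (stage m).
Proof.
move=> a b c [a0 _] [c0 cG] ab bc; split=> [l|g /cG[l lm lt]].
  apply/idP/idP => [|lm]; first by rewrite -c0; have := bc l; lia.
  by rewrite -a0 in lm; have := ab l; lia.
by exists l => //; have := bc l; lia.
Qed.

Lemma stage_torsion_convex m : convex (stage_torsion m).
Proof.
move=> a b c [Sa [g Gg ga]] [Sc _] ab bc; split; first exact: stage_convex Sa Sc ab bc.
by exists g => // l lm; have := ga l lm; have := ab l; lia.
Qed.

Lemma cohomology_index_convex k i : convex (cohomology_index k i).
Proof.
rewrite /cohomology_index; case: ifP => _; first exact: stage_torsion_convex.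
by case: ifP => _; [apply: stage_convex | move=> ? ? ? []].
Qed.

Lemma stage_torsionE (m : 'I_n) a :
  stage_torsion m.+1 a <->
  stage m.+1 a /\ exists N : nat, ~ stage m.+1 (up m N%:Z a).
Proof.
split=> -[Sa]; last first.
  case=> N nS; split=> //; apply: contrapT => no; apply: nS.
  have am0 : 0 <= a m by rewrite Sa.1.
  split=> [l|g Gg].
    rewrite -Sa.1 ffunE; case: (eqVneq l m) => [->|_]; last by rewrite addr0.
    by apply/idP/idP; lia.
  apply: contrapT => no2; apply: no; exists g => // l lm; rewrite leNgt.
  apply/negP => lt; apply: no2; exists l; first by rewrite ltnS ltnW.
  by rewrite up_neq // neq_ltn lm.
case=> g Gg hg; split=> //; exists (g m) => -[_ /(_ g Gg)[l lm]].
have am0 : 0 <= a m by rewrite Sa.1.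
rewrite ffunE; case: (eqVneq l m) => [->|lnm]; first by lia.
have := hg l; rewrite /= ltn_neqAle lnm -ltnS lm => /(_ isT).
by rewrite addr0; lia.
Qed.

(** This is the description of S' required by [presented_quotient]: when the m-th entry may be
    raised without limit, a generator can only be avoided in an earlier entry. *)
Lemma stageS (m : 'I_n) b :
  stage m b <->
  b m < 0 /\ forall N : nat, 0 <= b m + N%:Z -> stage m.+1 (up m N%:Z b).
Proof.
split=> [[b0 bG]|[bm hb]].
  split=> [|N bN]; first by rewrite ltNge b0 ltnn.
  split=> [l|g /bG[l lm lt]].
    rewrite ffunE ltnS leq_eqVlt (inj_eq val_inj) -b0; case: (eqVneq l m) => [->|lm] /=.
      by rewrite bN.
    by rewrite addr0.
  by exists l; [apply: ltnW | rewrite up_neq // neq_ltn lm].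
have hbig (N : nat) : (`|b m| <= N)%N -> stage m.+1 (up m N%:Z b).
  by move=> bN; apply: hb; lia.
split=> [l|g Gg].
  have [/(_ l)] := hbig _ (leqnn _); rewrite ffunE ltnS leq_eqVlt (inj_eq val_inj).
  case: (eqVneq l m) => [-> _ _|lm]; first by rewrite ltnn leNgt bm.
  by rewrite addr0.
(* This shift brings the m-th entry to exactly [g m], so the entry that avoids g is not the m-th. *)
have [_ /(_ g Gg)[l]] := hbig (`|b m| + g m)%N (leq_addr _ _).
rewrite ffunE ltnS leq_eqVlt (inj_eq val_inj).
case: (eqVneq l m) => [->|lm] /= => [_|lm' lt].
  by lia.
by exists l => //; move: lt; rewrite addr0.
Qed.

Definition to_mnm a : 'X_{1..n} := [multinom `|a l|%N | l < n].
Definition of_mnm u : Zn := [ffun l => (u l)%:Z].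

Lemma of_mnmK : cancel of_mnm to_mnm.
Proof. by move=> u; apply/mnmP => l; rewrite mnmE ffunE. Qed.

Lemma stage_to_mnmK a : stage n a -> of_mnm (to_mnm a) = a.
Proof.
move=> [a0 _]; apply/ffunP => l; rewrite ffunE mnmE.
by rewrite gez0_abs // a0.
Qed.

Lemma stage_of_mnm u : stage n (of_mnm u) <-> ~ in_ideal u.
Proof.
split=> [[_ h] [g Gg /mnm_lepP gu]|no].
  by have [l _] := h g Gg; rewrite ffunE; have := gu l; lia.
split=> [l|g Gg]; first by rewrite ffunE ltn_ord; lia.
apply: contrapT => no2; apply: no; exists g => //; apply/mnm_lepP => l.
rewrite leqNgt; apply/negP => lt; apply: no2; exists l; first exact: ltn_ord.
by rewrite ffunE; lia.
Qed.

Lemma stage_to_mnm a : stage n a -> ~ in_ideal (to_mnm a).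
Proof. by move=> Sa; apply/stage_of_mnm; rewrite stage_to_mnmK. Qed.

Lemma tdeg_to_mnm a : stage n a -> tdeg a = (mdeg (to_mnm a))%:Z.
Proof.
move=> Sa; rewrite -{1}(stage_to_mnmK Sa) /tdeg mdegE.
rewrite (big_morph Posz PoszD (erefl _)).
by apply: eq_bigr => l _; rewrite ffunE.
Qed.

(** Filter-regularity of X_m modulo I and the later variables, tested on monomials only; no field is
    left in the condition. *)
Definition eventually_regular : Prop :=
  forall m : 'I_n, exists D : nat, forall u,
    (forall l, (m < l)%N -> u l = 0%N) -> (D <= mdeg u)%N ->
    in_ideal (u + U_(m))%MM -> in_ideal u.

Section Regular.
Hypothesis hG : eventually_regular.

(* Dividing out X_n, ..., X_m one variable at a time never leaves the ideal   *)
(* as long as the degree of the remaining monomial is at least D.             *)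
Lemma saturation_bound : exists D : nat, forall m u,
  (forall l, (m <= l)%N -> u l = 0%N) -> (D <= mdeg u)%N ->
  (exists2 g, G g & forall l, (l < m.-1)%N -> (g l <= u l)%N) -> in_ideal u.
Proof.
have /choice[D hD] := hG.
exists (\max_l D l)%N => m u u0 Du [g Gg gu].
(* The exponents of u in positions m - 1 to t - 1 are raised to those of g where needed: [w n] is a
   multiple of g and [w m.-1] is u, so membership in I descends from t = n to t = m - 1. *)
pose w t : 'X_{1..n} :=
  [multinom if (m.-1 <= l < t)%N then maxn (u l) (g l) else u l | l < n].
have wu t : (u <= w t)%MM by apply/mnm_lepP => l; rewrite mnmE; case: ifP; lia.
have Dw t c l : (D l <= mdeg (w t + U_(l) *+ c))%N.
  apply: (@leq_trans (mdeg u)); last first.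
    by rewrite mdegD -(submK (wu t)) mdegD; lia.
  by apply: leq_trans Du; apply: (leq_bigmax l).
have hw s : (m.-1 <= n - s)%N -> in_ideal (w (n - s)%N).
  elim: s => [|s IH] hs.
    exists g => //; apply/mnm_lepP => l; rewrite mnmE subn0 ltn_ord andbT.
    by case: ifP => h; [lia | apply: gu; lia].
  case: (leqP n s) => ns.
    by have <- : (n - s = n - s.+1)%N by [lia]; apply: IH; lia.
  have tn : (n - s.+1 < n)%N by lia.
  pose t := Ordinal tn.
  have wE : w (n - s)%N = (w t + U_(t) *+ (g t - u t))%MM.
    apply/mnmP => l; rewrite mnmDE mulmnE !mnmE.
    case: (eqVneq t l) => [<-|/eqP tl].
      by rewrite mul1n /=; do 2!case: ifP; lia.
    rewrite mul0n addn0; have : nat_of_ord t <> l by move=> e; apply: tl; apply: val_inj.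
    by move=> /= ?; do 2!case: ifP => //; lia.
  have : in_ideal (w t + U_(t) *+ (g t - u t))%MM by rewrite -wE; apply: IH; lia.
  elim: (g t - u t)%N => [|c IHc]; first by rewrite mulm0n addm0.
  rewrite mulmSr addmA => h; apply: IHc; apply: hD h; last exact: Dw.
  move=> l lt; rewrite mnmDE mulmnE !mnmE.
  have -> : (t == l) = false by apply/negbTE; rewrite neq_ltn lt.
  rewrite mul0n addn0; case: ifP => [|_]; first by move: lt => /=; lia.
  by apply: u0; move: lt hs => /=; lia.
case: (leqP m.-1 n) => mn.
  have -> : u = w m.-1.
    by apply/mnmP => l; rewrite mnmE; case: ifP => //; lia.
  by have := hw (n - m.-1)%N; rewrite subKn //; apply.
exists g => //; apply/mnm_lepP => l; apply: gu.
by have := ltn_ord l; lia.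
Qed.

(** The monomial formed by the entries before m satisfies the divisibility condition in
    [saturation_bound]; in large degree it would lie in I, which [stage] forbids. *)
Lemma stage_torsion_bound : exists D : nat, forall m a, stage_torsion m a ->
  \sum_(l < n | (l < m)%N) a l < D%:Z.
Proof.
have [D hD] := saturation_bound; exists D => m a [[a0 aG] [g Gg ga]].
pose u : 'X_{1..n} := [multinom if (l < m)%N then `|a l|%N else 0%N | l < n].
have -> : \sum_(l < n | (l < m)%N) a l = (mdeg u)%:Z.
  rewrite mdegE (big_morph Posz PoszD (erefl _)) big_mkcond /=.
  by apply: eq_bigr => l _; rewrite mnmE -a0; case: ifP => //; lia.
rewrite ltNge; apply/negP => Du.
have [|||g' Gg' /mnm_lepP gu] := hD m u.
- by move=> l ml; rewrite mnmE ltnNge ml.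
- by lia.
- exists g => // l lm; have lm' : (l < m)%N by lia.
  by rewrite mnmE lm'; have := ga l lm; have := a0 l; rewrite lm'; lia.
have [l lm lt] := aG g' Gg'; have := gu l; rewrite mnmE lm.
by have := a0 l; rewrite lm; lia.
Qed.

(** Below degree k, raising a nonnegative entry by D breaks the bound of [stage_torsion_bound]. Thus
    every variable not yet added acts nilpotently on each class outside degree k. *)
Lemma cohomology_index_nilp k i a l : (k <= n)%N -> i != k ->
  (l < n - k)%N ->
  cohomology_index k i a -> exists N : nat, ~ cohomology_index k i (up l N%:Z a).
Proof.
rewrite /cohomology_index => kn ik lk; case: ltnP => [lt|_]; last by rewrite (negPf ik).
have [D hD] := stage_torsion_bound.
move=> Ta; exists D => /hD; rewrite ltNge => /negP; apply.
have lm : (l < n - i)%N by lia.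
rewrite (bigD1 l) //= upE.
have : 0 <= a l by rewrite Ta.1.1.
have : 0 <= \sum_(i0 < n | (i0 < n - i)%N && (i0 != l)) up l D a i0.
  by apply: sumr_ge0 => l' /andP[lm' ll']; rewrite up_neq // Ta.1.1.
by move=> ? ?; rewrite addrAC lerDr addr_ge0.
Qed.

(** The nonnegative entries have bounded sum, and the fixed total degree then bounds the negative
    ones. *)
Lemma cohomology_index_finite i (j : int) : exists s : seq Zn, forall a,
  cohomology_index n i a -> tdeg a = j -> a \in s.
Proof.
have [D hD] := stage_torsion_bound.
pose B := (D + `|j|)%N.
exists [seq [ffun l => (f l : nat)%:Z - B%:Z] | f : {ffun 'I_n -> 'I_(B + B).+1}].
move=> a ha aj.
(* The bound is [D.+1] because in degree n the sum is empty and D may be 0. *)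
have [m [a0 sm]] : exists m, (forall l, (0 <= a l) = (l < m)%N) /\
    \sum_(l < n | (l < m)%N) a l < D.+1%:Z.
  move: ha; rewrite /cohomology_index; case: ifP => [_ Ta|_].
    exists (n - i)%N; split; first exact: Ta.1.1.
    by have := hD _ _ Ta; lia.
  case: eqP => // -> [a0 _]; exists (n - n)%N; split=> //.
  by rewrite subnn big1 //; lia.
have bnd l : `|a l| <= B%:Z.
  have e : j = \sum_(l < n | (l < m)%N) a l + \sum_(l < n | ~~ (l < m)%N) a l.
    by rewrite -aj /tdeg (bigID (fun l : 'I_n => (l < m)%N)).
  have neg : \sum_(l < n | ~~ (l < m)%N) a l <= 0.
    by apply: sumr_le0 => l'; rewrite -a0; lia.
  have pos : 0 <= \sum_(l < n | (l < m)%N) a l by apply: sumr_ge0 => l'; rewrite -a0.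
  case: (boolP (l < m)%N) => lm.
    have : a l <= \sum_(l < n | (l < m)%N) a l.
      rewrite (bigD1 l) //= lerDl; apply: sumr_ge0 => l' /andP[+ _].
      by rewrite -a0.
    by move: (lm); rewrite -a0; rewrite /B; lia.
  have : \sum_(l < n | ~~ (l < m)%N) a l <= a l.
    rewrite (bigD1 l) //= gerDl; apply: sumr_le0 => l' /andP[+ _].
    by rewrite -a0; lia.
  by move: (lm); rewrite -a0; rewrite /B; lia.
apply/imageP; exists [ffun l => inord `|(a l + B%:Z)%R|%N] => //.
apply/ffunP => l; have := bnd l; rewrite ler_norml => /andP[lo hi].
have al : 0 <= a l + B%:Z by rewrite -(subrK B%:Z 0) lerD2r sub0r.
rewrite !ffunE inordK; first by rewrite gez0_abs // addrK.
by rewrite ltnS -lez_nat gez0_abs // PoszD lerD2r.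
Qed.

End Regular.

End IndexSets.

(** * Weak stability in terms of exponents *)

Section MonomialQuotient.
Variables (K : fieldType) (n : nat) (G : 'X_{1..n} -> Prop).
Local Notation Zn := {ffun 'I_n -> int}.
Local Notation I := (monomial_ideal K G).
Implicit Types (l m : 'I_n) (u : 'X_{1..n}) (p : {mpoly K[n]}).

Lemma nth_rev_vars m :
  [seq ('X_i : {mpoly K[n]}) | i <- rev (enum 'I_n)]`_(n - m.+1) = 'X_m.
Proof.
have lt : (n - m.+1 < n)%N by have := ltn_ord m; lia.
rewrite (nth_map m) ?size_rev ?size_enum_ord // nth_rev ?size_enum_ord //.
by congr 'X_(_); apply: val_inj; rewrite /= nth_enum_ord; have := ltn_ord m; lia.
Qed.

Lemma take_rev_vars m x :
  x \in take (n - m.+1) [seq ('X_i : {mpoly K[n]}) | i <- rev (enum 'I_n)] ->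
  exists2 l : 'I_n, (m < l)%N & x = 'X_l.
Proof.
rewrite -map_take => /mapP[l + ->] => /(nthP m)[i].
rewrite size_take size_rev size_enum_ord.
have -> : (n - m.+1 < n)%N by have := ltn_ord m; lia.
move=> im; rewrite nth_take // nth_rev ?size_enum_ord; last by lia.
move=> lE; exists l => //; rewrite -lE nth_enum_ord; lia.
Qed.

(** If X_m u lies in I, filter-regularity makes u vanish modulo I and the later variables once its
    degree is large. Multiples of those variables have coefficient 0 at u, which does not involve
    them, so u itself lies in I. The variable X_m has position [n - m.+1] in the reversed list. *)
Lemma weakly_stable_regular : weakly_stable I -> eventually_regular G.
Proof.
move=> hI m; have [|_ [d0 hd]] := hI (n - m.+1)%N.
  by rewrite size_map size_rev size_enum_ord; have := ltn_ord m; lia.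
exists `|d0|%N => u u0 Du uI.
set J := mul_submodule _ _ in hd.
pose x : gquot J := lmod_pi J (lmod_pi I ('X_[u] : {mpoly K[n]})).
have x0 : x = 0.
  apply: (hd (mdeg u)%:Z); first by lia.
  - rewrite /homogeneous_of /= gquot_part_pi /= gquot_part_pi /=.
    by rewrite pihomog_dE // dhomogX.
  - exact: gpart0.
  rewrite scaler0 nth_rev_vars /x -linearZ /= -linearZ /=.
  have -> : lmod_pi I ('X_m *: ('X_[u] : gpoly K n)) = 0.
    apply/lmod_pi_eq0/mem_monomial_ideal => v.
    by rewrite /GRing.scale /= -mpolyXD msuppX inE addmC => /eqP ->.
  exact: raddf0.
have /asboolP[s hs xE] := (lmod_pi_eq0 _ _).1 x0.
(* The classes with a representative having coefficient 0 at u; they contain every multiple of a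
   later variable and are closed under sums. *)
pose P (y : gquot I) :=
  exists2 f : gpoly K n, lmod_pi I f = y & (f : {mpoly K[n]})@_u = 0.
have [f fE fu] : P (lmod_pi I ('X_[u] : {mpoly K[n]})).
  rewrite xE big_seq; apply: (big_ind P) => [|y z [f <- fu] [g <- gu]|t ts].
  - by exists 0; rewrite ?raddf0 ?mcoeff0.
  - exists (f + g); first by rewrite raddfD.
    by rewrite -[RHS]addr0 -{1}fu -gu; apply: mcoeffD.
  have [[_ /take_rev_vars[l ml ->] [y ->]] _] := hs t ts.
  exists ((t.1 * 'X_l) *: lmod_repr y); first by rewrite linearZ /= lmod_reprK scalerA.
  rewrite /GRing.scale /= mulrAC mcoeffM_X; case: ifP => // /mnm_lepP/(_ l).
  by rewrite mnmE eqxx u0.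
have /lmod_piP/mem_monomial_ideal h := esym fE; apply: h.
rewrite mcoeff_msupp; have -> : ('X_[u] - (f : {mpoly K[n]}))@_u = 1.
  by rewrite mcoeffB mcoeffX eqxx fu subr0.
exact: oner_neq0.
Qed.



Lemma mcoeff_gpoly_part (j : int) p u :
  (gpoly_part j p : {mpoly K[n]})@_u = if (mdeg u)%:Z == j then p@_u else 0.
Proof.
case: j => k /=; last by rewrite mcoeff0.
rewrite eqz_nat pihomogE raddf_sum /=.
under eq_bigr do rewrite mcoeffZ mcoeffX.
case: (boolP (u \in msupp p)) => [up|nup]; last first.
  rewrite (memN_msupp_eq0 nup) if_same; rewrite big_seq_cond big1 // => v /andP[vp _].
  by case: eqP => [vu|_]; [rewrite -vu vp in nup | rewrite mulr0].
case: eqP => [uk|nuk]; last first.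
  rewrite big1 // => v /eqP vk.
  by case: eqP => [vu|_]; [rewrite -vu vk in nuk | rewrite mulr0].
rewrite big_mkcond (bigD1_seq u) ?msupp_uniq //= uk !eqxx mulr1.
by rewrite big1 ?addr0 // => v /negPf->; rewrite mulr0 if_same.
Qed.

End MonomialQuotient.

(** * Adding the variables one by one, and counting dimensions *)

Section LocalCohomologyOfMonomialQuotient.
Variables (K : fieldType) (n : nat) (G : 'X_{1..n} -> Prop).
Local Notation Zn := {ffun 'I_n -> int}.
Local Notation I := (monomial_ideal K G).
Variable E : injective_resolution (gquot I).
Implicit Types (l m : 'I_n) (u : 'X_{1..n}) (p : {mpoly K[n]}).
Local Notation d := (res_diff E).

Lemma res_dd i x : d i.+1 (d i x) = 0.
Proof. by apply/res_exactS; exists x. Qed.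

(** For empty L the complex is the whole resolution, whose H^0 is A/I through the augmentation, with
    the monomials outside I as basis. *)
Lemma presented_aug : presented d set0 0 (stage G n).
Proof.
pose aug (p : {mpoly K[n]}) : E 0 := res_aug E (lmod_pi I p).
have augP c p q : aug (c *: (p : gpoly K n) + q) = c *: aug p + aug q.
  by rewrite /aug !linearP.
have aug0 p : (forall a, stage G n a -> p@_(to_mnm a) = 0) <-> aug p = 0.
  have -> : aug p = 0 <-> p \in I.
    rewrite -lmod_pi_eq0; split=> [|h]; last by rewrite /aug h linear0.
    by rewrite /aug -(linear0 (res_aug E)); apply: res_aug_inj.
  rewrite mem_monomial_ideal; split=> [h u up|h a Sa].
    apply: contrapT => /stage_of_mnm/h; rewrite of_mnmK; apply/eqP.
    by rewrite -mcoeff_msupp.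
  apply/eqP; rewrite mcoeff_eq0; apply/negP => /h; exact: stage_to_mnm.
have aug_cocycle p : cocycle d set0 (aug p).
  split=> [l|]; first by rewrite inE.
  by apply/res_exact0; exists (lmod_pi I p).
exists (fun z f => exists2 p, z = aug p &
  f = fun a => if `[< stage G n a >] then p@_(to_mnm a) else 0).
split.
- by move=> _ _ [p -> _].
- by move=> _ _ a [p _ ->]; case: asboolP => //; rewrite eqxx.
- move=> _ _ [p _ ->]; exists [seq of_mnm u | u <- msupp p] => a.
  case: asboolP; rewrite ?eqxx // => Sa; rewrite -mcoeff_msupp => h.
  by rewrite -(stage_to_mnmK Sa) map_f.
- move=> c _ _ _ _ [p -> ->] [q -> ->].
  exists (c%:MP *: (p : gpoly K n) + q); first by rewrite augP.
  apply/funext => a; case: asboolP => _; last by rewrite mulr0 addr0.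
  by rewrite -mcoeffCM -mcoeffD.
- move=> l _ _ [p -> ->]; exists ('X_l * p).
    by rewrite /aug -linearZ /= -linearZ.
  apply/funext => a; case: asboolP => // Sa.
  rewrite mulrC mcoeffM_X.
  have -> : (U_(l) <= to_mnm a)%MM = (0 < a l).
    have := Sa.1 l; rewrite ltn_ord => al.
    apply/mnm_lepP/idP => [/(_ l)|lt k]; first by rewrite !mnmE eqxx; lia.
    by rewrite !mnmE; case: eqP => [<-|] //; lia.
  case: (boolP (0 < a l)) => [al|nal]; last first.
    by rewrite asboolF // => -[/(_ l)]; rewrite upE ltn_ord; lia.
  rewrite asboolT.
    congr (_@__); apply/mnmP => k; rewrite mnmBE !mnmE ffunE (eq_sym l).
    case: (eqVneq k l) => [->|_]; last by rewrite addr0 subn0.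
    by lia.
  split=> [k|g /(Sa.2)[k _ lt]].
    rewrite ffunE ltn_ord; case: eqP => [->|_]; first by lia.
    by rewrite addr0 Sa.1 ltn_ord.
  exists k; first exact: ltn_ord.
  by rewrite ffunE; case: eqP; lia.
- move=> _ _ [p -> ->]; rewrite /= -aug0; split=> [h a Sa|h a].
    by have := h a; rewrite asboolT.
  by case: asboolP => // /h.
- move=> z [_ /res_exact0[x ->]]; eexists; exists (lmod_repr x) => //.
  by rewrite /aug lmod_reprK.
- move=> f [s hs] hf; eexists.
  exists (\sum_(a <- undup s) f a *: 'X_[to_mnm a]); first by [].
  apply/funext => a; rewrite raddf_sum /=.
  case: asboolP => [Sa|nS]; last by apply/eqP/negPn/negP => /hf.
  under eq_bigr do rewrite mcoeffZ mcoeffX.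
  have zero b : b != a -> f b * (to_mnm b == to_mnm a)%:R = 0.
    move=> ba; case: (eqVneq (f b) 0) => [->|/hf Sb]; first by rewrite mul0r.
    case: eqP => [e|_]; last by rewrite mulr0.
    by rewrite -(stage_to_mnmK Sb) e (stage_to_mnmK Sa) eqxx in ba.
  case: (boolP (a \in s)) => as_.
    rewrite (bigD1_seq a) ?undup_uniq ?mem_undup //= eqxx mulr1.
    by rewrite big1 ?addr0 // => b /zero.
  rewrite big_seq big1; first by apply/eqP/negPn/negP => /hs; apply/negP.
  by move=> b; rewrite mem_undup => bs; apply: zero; apply: contraNneq as_ => <-.
- move=> j _ _ [p -> ->]; exists (gpoly_part j p).
    by rewrite /aug -res_aug_degree0 /= gquot_part_pi.
  apply/funext => a; case: asboolP => [Sa|_]; last by rewrite if_same.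
  by rewrite mcoeff_gpoly_part (tdeg_to_mnm Sa).
Qed.

(** The step from k to k + 1 adds X_m with m = n - k - 1. The new degree k + 1 is the cokernel of
    localization on the old degree k, as the old degree k + 1 was zero. Degree k keeps only its
    X_m-torsion, and lower degrees, already X_m-torsion, stay unchanged. *)
Lemma presented_cohomology k i : eventually_regular G -> (k <= n)%N ->
  presented d [set l : 'I_n | (n - k <= l)%N] i (cohomology_index G k i).
Proof.
move=> hG; elim: k i => [|k IH] i kn.
  rewrite subn0; have -> : [set l : 'I_n | (n <= l)%N] = set0.
    by apply/setP => l; rewrite !inE leqNgt ltn_ord.
  case: i => [|i]; first by rewrite /cohomology_index subn0; apply: presented_aug.
  apply: (presented_empty (@res_diff_degree0 _ _ _ E) res_dd).
  by move=> z [_ /res_exactS[y ->]]; exists y => // l; rewrite inE.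
have lt : (n - k.+1 < n)%N by lia.
pose m := Ordinal lt.
have -> : [set l : 'I_n | (n - k.+1 <= l)%N] = m |: [set l : 'I_n | (n - k <= l)%N].
  apply/setP => l; rewrite !inE -val_eqE /=; lia.
have mE : (n - k)%N = m.+1 by rewrite /=; lia.
have {}IH j := IH j (ltnW kn).
have hdiv j (x : E j) : var_torsion [set l : 'I_n | (n - k <= l)%N] x ->
    exists2 y, var_torsion [set l : 'I_n | (n - k <= l)%N] y & 'X_m *: y = x.
  apply: injective_div; first exact: res_inj.
  by rewrite inE mE /= ltnn.
have nilp j a : j != k -> cohomology_index G k j a ->
    exists N : nat, ~ cohomology_index G k j (up m N%:Z a).
  move=> jk; apply: cohomology_index_nilp => //; first exact: ltnW.
  by rewrite mE.
have stE : cohomology_index G k k = stage G m.+1.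
  by rewrite /cohomology_index ltnn eqxx mE.
have resE := @res_diff_degree0 _ _ _ E.
have [->|ik] := eqVneq i k.+1.
  have -> : cohomology_index G k.+1 k.+1 = stage G m.
    by rewrite /cohomology_index ltnn eqxx.
  have := IH k.+1; rewrite /cohomology_index ltnNge leqnSn gtn_eqF //= => IH1.
  have IHk := IH k; rewrite stE in IHk.
  apply: (presented_quotient resE res_dd hdiv (@stage_convex _ G m.+1) _ _
            (stageS G m) IHk IH1).
    by move=> a Sa; rewrite Sa.1.
  move=> a N Sa aN; split=> [l|g /(Sa.2)[l lm lt']].
    by rewrite ffunE -Sa.1; case: eqP => [->|_]; rewrite ?addr0 // Sa.1 ltnSn subr_ge0.
  by exists l => //; apply: le_lt_trans lt'; apply: le_up_exp; lia.
have Ti : presented d (m |: [set l : 'I_n | (n - k <= l)%N]) i (fun a =>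
    cohomology_index G k i a /\ exists N : nat, ~ cohomology_index G k i (up m N%:Z a)).
  apply: (presented_torsion resE res_dd hdiv) (IH i).
    exact: cohomology_index_convex.
  case: i ik => // i ik y hy; have [R hR] := IH i.
  have [f hf] := pres_total hR hy.
  apply: (pres_nilp hR (@cohomology_index_convex _ G _ _) hf) => a /(pres_supp hR hf).
  by apply: nilp; apply: contraNneq ik => ->.
apply: eq_presented Ti => a; have [ik'|ik'] := eqVneq i k.
  rewrite ik' stE -stage_torsionE /cohomology_index ltnSn mE.
  by [].
have -> : cohomology_index G k.+1 i = cohomology_index G k i.
  rewrite /cohomology_index (negPf ik) (negPf ik').
  by have -> : (i < k.+1)%N = (i < k)%N by lia.
by split=> [[]|Ta] //; split=> //; apply: nilp.
Qed.

Lemma lc_cocycleE i (j : int) (z : E i) :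
  lc_cocycle j z <-> homogeneous_of j z /\ cocycle d setT z.
Proof.
split=> [[hz /torsionE tz dz]|[hz [tz dz]]]; split=> //; exact/torsionE.
Qed.

Lemma lc_coboundaryE i (j : int) (z : E i) : homogeneous_of j z ->
  lc_coboundary j z <-> coboundary d setT z.
Proof.
case: i z => [|i] z hz //=; split=> [[y [_ /torsionE ty ->]]|[y ty zE]].
  by exists y.
exists (gpart j y); split.
- by rewrite /homogeneous_of gpart_gpart eqxx.
- exact/torsionE/vt_gpart.
- by rewrite res_diff_degree0 -zE hz.
Qed.

Lemma lc_dim_presented i (j : int) S (r : seq Zn) : presented d setT i S ->
  uniq r -> (forall a, a \in r <-> S a /\ tdeg a = j) ->
  quot_dim (@lc_cocycle _ _ _ E i j) (@lc_coboundary _ _ _ E i j) (size r).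
Proof.
move=> [R hR] ur rE; pose t (k : 'I_(size r)) := tnth (in_tuple r) k.
have tr k : t k \in r by apply: mem_tnth.
have tinj k k' : (t k == t k') = (k == k').
  by apply: inj_eq; apply/tuple_uniqP.
have /choice[v hv] : forall k, exists z : E i,
    homogeneous_of j z /\ R z (fun a => (a == t k)%:R).
  move=> k; have [Sk dk] := (rE (t k)).1 (tr k).
  have [||z hz] := pres_surj hR (f := fun a => (a == t k)%:R).
  - by exists [:: t k] => a; rewrite inE; case: (a == t k); rewrite ?eqxx.
  - by move=> a; case: (eqVneq a (t k)) => [->|_]; rewrite ?eqxx.
  (* The degree j component represents the same class, because the exponent [t k] has total degree
     j. *)
  exists (gpart j z); split; first by rewrite /homogeneous_of gpart_gpart eqxx.
  apply: (pres_eq (pres_deg hR j hz)) => a.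
  by case: (eqVneq a (t k)) => [->|]; rewrite ?dk ?eqxx // if_same.
have sumE (c : 'rV[K]_(size r)) k : \sum_k' c 0 k' * (t k == t k')%:R = c 0 k.
  rewrite (bigD1 k) //= eqxx mulr1 big1 ?addr0 // => k' kk'.
  by rewrite tinj eq_sym (negPf kk') mulr0.
have sumR (c : 'rV[K]_(size r)) :=
  pres_sum res_dd hR (index_enum _) (c 0) (fun k => (hv k).2).
exists v => [k|z /lc_cocycleE[hz cz]].
  by apply/lc_cocycleE; split; [apply: (hv k).1|apply: (pres_cocycle hR (hv k).2)].
have [f hf] := pres_total hR cz.
have f0 a : a \notin r -> f a = 0.
  move=> ar; have := pres_deg hR j hf; rewrite hz => hf'.
  rewrite (pres_fun hR hf hf'); case: eqP => // aj.
  apply/eqP/negPn/negP => /(pres_supp hR hf) Sa; case/negP: ar.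
  exact/rE.
have hdiff (c : 'rV[K]_(size r)) : homogeneous_of j (z - \sum_k (c 0 k)%:MP *: v k).
  rewrite /homogeneous_of gpartB hz gpart_bigsum; congr (_ - _).
  apply: eq_bigr => k _; have [vk _] := hv k.
  have C0 : ((c 0 k)%:MP : {mpoly K[n]}) \is 0.-homog.
    by rewrite -[_%:MP]mulr1 mul_mpolyC dhomogZ ?dhomog1.
  by have := gpartZ j (v k) C0; rewrite addr0 => ->; rewrite vk.
exists (\row_k f (t k)); split.
  apply/lc_coboundaryE => //; apply/(pres_ker hR (pres_sub hR hf (sumR _))) => a.
  case: (boolP (a \in r)) => [/(tnthP (in_tuple r))[k ->]|ar].
    by rewrite sumE mxE subrr.
  rewrite (f0 _ ar) big1 ?subr0 // => k _.
  by case: eqP => [ak|_]; [rewrite ak tr in ar | rewrite mulr0].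
move=> c /(lc_coboundaryE (hdiff c)) /(pres_ker hR (pres_sub hR hf (sumR c))) h.
apply/rowP => k; rewrite mxE; apply/eqP; rewrite -subr_eq0 -[c 0 k]sumE; apply/eqP.
exact: h.
Qed.

End LocalCohomologyOfMonomialQuotient.

Theorem theorem1p3 (K : fieldType) (n : nat) (G : 'X_{1..n} -> Prop)
  (hG : weakly_stable (monomial_ideal K G))
  (E : injective_resolution (gquot (monomial_ideal K G)))
  (EQ : injective_resolution (gquot (monomial_ideal rat G)))
  (i : nat) :
  exists2 h : int -> nat, lc_Hilb E i h & lc_Hilb EQ i h.
Proof.
have regG := weakly_stable_regular hG.
(* The lists [r j] are built from [G] alone, so their sizes give the Hilbert function over both
   fields. *)
have /choice[r hr] : forall j : int, exists r : seq {ffun 'I_n -> int}, uniq r /\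
    forall a, a \in r <-> cohomology_index G n i a /\ tdeg a = j.
  move=> j; have [s hs] := cohomology_index_finite regG i j.
  exists [seq a <- undup s | `[< cohomology_index G n i a /\ tdeg a = j >]].
  split=> [|a]; first by rewrite filter_uniq ?undup_uniq.
  rewrite mem_filter mem_undup; split=> [/andP[/asboolP]|h] //.
  by rewrite asboolT //; apply: hs; case: h.
have setTE : [set l : 'I_n | (n - n <= l)%N] = setT.
  by apply/setP => l; rewrite !inE subnn.
exists (fun j => size (r j)) => j; have [ur rE] := hr j.
  by apply: lc_dim_presented ur rE; rewrite -setTE; apply: presented_cohomology.
by apply: lc_dim_presented ur rE; rewrite -setTE; apply: presented_cohomology.
Qed.
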